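(* The $K_5$ descendants of level $2$ are precisely the completed primitive $2$-zigzag graphs of order $\ge 8$. Moreover, if $a_n$ denotes the number of isomorphism classes of such graphs with $n$ vertices, then \[ \sum_{n\ge 0} a_n x^n=\frac{x^8}{(1-x)(1-x^2)}. \]
   Context: Graphs are finite, simple and undirected, considered up to isomorphism. Double triangle expansion (DTE): let $G$ be a $4$-regular graph containing four distinct vertices $v_1,v_2,v_3,v_4$ such that $\{v_1,v_2,v_3\}$ is a triangle and $\{v_2,v_4\}$ is an edge. The DTE of $G$ at this subgraph is obtained by deleting the edges $\{v_1,v_3\}$ and $\{v_2,v_4\}$ and adding one new vertex adjacent to exactly $v_1,v_2,v_3,v_4$. A $K_5$ descendant is a graph obtained from $K_5$ by a finite (possibly empty) sequence of DTEs. The order of a graph is its number of vertices. The level of $G$ is $L(G)=$ (number of vertices of $G$) $-$ (number of triangles of $G$). A $4$-regular graph is completed primitive if it is internally $6$-edge-connected, i.e. it is connected and the only way to disconnect it by removing at most $5$ edges is to separate off a single vertex. For $n\ge1$ the zigzag $Z_n^*$ is the graph with vertex set $\{1,\dots,n+2\}$ and edges $\{i,i+1\}$ ($1\le i\le n+1$) and $\{i,i+2\}$ ($1\le i\le n$); its end vertices are $1$ and $n+2$. A zigzag subgraph of $G$ is maximal if it is not a proper subgraph of any other zigzag subgraph of $G$. For $k_1,k_2\ge 1$, the closed $(k_1,k_2)$-chain is obtained from disjoint copies of $Z_{k_1}^*$ and $Z_{k_2}^*$ by identifying the two end vertices of the first with the two end vertices of the second, in pairs. A $2$-zigzag graph is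 a $4$-regular simple graph obtained from a closed $(k_1,k_2)$-chain, for some $k_1,k_2\geq 1$, by adding edges (no vertices), in such a way that the two zigzags of the chain are maximal zigzag subgraphs of the resulting graph. *)

(* Defs.v *)
From HB Require Import structures.
From mathcomp Require Import all_boot all_order all_algebra.
From mathcomp Require Import boolp.

Set Implicit Arguments.
Unset Strict Implicit.
Unset Printing Implicit Defensive.

Import GRing.Theory.

Record sgraph := SGraph {
  vertex :> finType;
  adj : rel vertex;
  adj_sym : symmetric adj;
  adj_irr : irreflexive adj }.

Definition graph_order (G : sgraph) : nat := #|G|.

Definition iso (G H : sgraph) : Prop :=
  exists2 f : G -> H, bijective f & forall x y, adj (f x) (f y) = adj x y.

Definition edges (G : sgraph) : {set {set G}} :=
  [set [set p.1; p.2] | p in [set p : G * G | adj p.1 p.2]].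

Definition regular4 (G : sgraph) : Prop := forall x : G, #|[set y | adj x y]| = 4.

Definition triangles (G : sgraph) : {set {set G}} :=
  [set A : {set G} |
    (#|A| == 3) && [forall x in A, forall y in A, (x != y) ==> adj x y]].

Definition level (G : sgraph) : int := ((graph_order G)%:Z - #|triangles G|%:Z)%R.

(* The new vertex of the expansion is [None]. *)
Section DoubleTriangleExpansion.

Variables (G : sgraph) (v1 v2 v3 v4 : G).

Definition dte_adj (x y : option G) : bool :=
  match x, y with
  | Some a, Some b =>
      [&& adj a b, [set a; b] != [set v1; v3] & [set a; b] != [set v2; v4]]
  | Some a, None | None, Some a => a \in [set v1; v2; v3; v4]
  | None, None => false
  end.

Lemma dte_adj_sym : symmetric dte_adj.
Proof. by move=> [a|] [b|] //=; rewrite adj_sym (setUC [set a]). Qed.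

Lemma dte_adj_irr : irreflexive dte_adj.
Proof. by move=> [a|] //=; rewrite adj_irr. Qed.

Definition dte : sgraph := SGraph dte_adj_sym dte_adj_irr.

Definition dte_site : Prop :=
  [/\ uniq [:: v1; v2; v3; v4],
      [/\ adj v1 v2, adj v2 v3 & adj v1 v3] & adj v2 v4].

End DoubleTriangleExpansion.

Lemma neq_sym (T : eqType) : symmetric (fun x y : T => x != y).
Proof. by move=> x y; rewrite eq_sym. Qed.

Lemma neq_irr (T : eqType) : irreflexive (fun x y : T => x != y).
Proof. by move=> x; rewrite eqxx. Qed.

Definition complete_graph (n : nat) : sgraph :=
  SGraph (@neq_sym 'I_n) (@neq_irr 'I_n).

Inductive K5_descendant : sgraph -> Prop :=
| K5_descendant_base : K5_descendant (complete_graph 5)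
| K5_descendant_dte (G : sgraph) (v1 v2 v3 v4 : G) :
    K5_descendant G -> regular4 G -> dte_site v1 v2 v3 v4 ->
    K5_descendant (dte v1 v2 v3 v4)
| K5_descendant_iso (G H : sgraph) :
    K5_descendant G -> iso G H -> K5_descendant H.

Definition connected_rel (T : finType) (r : rel T) : Prop :=
  0 < #|T| /\ forall x y : T, connect r x y.

Definition remove_edges (G : sgraph) (F : {set {set G}}) : rel G :=
  fun x y => adj x y && ([set x; y] \notin F).

(* The last clause says that the components left after removing [F] are
   exactly [{v}] and its complement. *)
Definition internally_6_edge_connected (G : sgraph) : Prop :=
  connected_rel (@adj G) /\
  forall F : {set {set G}}, F \subset edges G -> #|F| <= 5 ->
    ~ connected_rel (remove_edges F) ->
    exists v : G, forall x y : G,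
      connect (remove_edges F) x y = ((x == v) == (y == v)).

Definition completed_primitive (G : sgraph) : Prop :=
  regular4 G /\ internally_6_edge_connected G.

(* Vertices are numbered from 0; the end vertices are 0 and n.+1. *)
Definition zigzag_adj (n : nat) (i j : 'I_n.+2) : bool :=
  [|| j == i.+1 :> nat, j == i.+2 :> nat, i == j.+1 :> nat | i == j.+2 :> nat].

Lemma zigzag_adj_sym n : symmetric (@zigzag_adj n).
Proof. by move=> i j; rewrite /zigzag_adj orbA orbC -orbA. Qed.

Lemma zigzag_adj_irr n : irreflexive (@zigzag_adj n).
Proof.
move=> i; rewrite /zigzag_adj.
by rewrite !(ltn_eqF (ltnSn _)) (ltn_eqF (leqnSn i.+1)).
Qed.

Definition zigzag (n : nat) : sgraph :=
  SGraph (@zigzag_adj_sym n) (@zigzag_adj_irr n).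

(* The vertices of the chain are those of the first zigzag, 0, ..., k1.+1,
   followed by the k2 inner vertices of the second one. The second zigzag runs
   through k1.+1, k1.+2, ..., k1 + k2 + 1, 0: its end vertices 0 and k2.+1 are
   glued to the end vertices k1.+1 and 0 of the first. Zigzags have a symmetry
   exchanging their ends, so the other pairing gives an isomorphic graph. *)
Section ClosedChain.

Variables k1 k2 : nat.

Lemma chain_fst_subproof : k1.+2 <= (k1 + k2).+2.
Proof. by rewrite !ltnS leq_addr. Qed.

Definition chain_fst (i : zigzag k1) : 'I_(k1 + k2).+2 :=
  widen_ord chain_fst_subproof i.

Definition chain_snd (j : zigzag k2) : 'I_(k1 + k2).+2 :=
  Ordinal (ltn_pmod (k1.+1 + j) (ltn0Sn (k1 + k2).+1)).

Definition chain_adj (x y : 'I_(k1 + k2).+2) : bool :=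
  [exists i, exists j, [&& adj i j, x == chain_fst i & y == chain_fst j]] ||
  [exists i, exists j, [&& adj i j, x == chain_snd i & y == chain_snd j]].

Lemma chain_fst_inj : injective chain_fst.
Proof. by move=> i j /(congr1 val) /= /val_inj. Qed.

Lemma chain_snd_inj : injective chain_snd.
Proof.
move=> i j /(congr1 val) /= /eqP; rewrite eqn_modDl !modn_small.
- by move=> /eqP /val_inj.
- by rewrite (leq_trans (ltn_ord j)) // !ltnS leq_addl.
- by rewrite (leq_trans (ltn_ord i)) // !ltnS leq_addl.
Qed.

Lemma chain_adj_sym : symmetric chain_adj.
Proof.
suff H x y : chain_adj x y -> chain_adj y x by move=> x y; apply/idP/idP; exact: H.
by case/orP => /existsP[i /existsP[j /and3P[ij xi yj]]]; apply/orP; [left|right];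
  apply/existsP; exists j; apply/existsP; exists i; rewrite adj_sym ij xi yj.
Qed.

Lemma chain_adj_irr : irreflexive chain_adj.
Proof.
move=> x; apply/negP.
case/orP => /existsP[i /existsP[j /and3P[ij /eqP-> /eqP]]].
- by move=> /chain_fst_inj eij; rewrite eij adj_irr in ij.
- by move=> /chain_snd_inj eij; rewrite eij adj_irr in ij.
Qed.

Definition closed_chain : sgraph := SGraph chain_adj_sym chain_adj_irr.

End ClosedChain.

(* A subgraph (not necessarily induced) is given by its vertices and edges. *)
Definition subgraph (G : sgraph) : Type := ({set G} * {set {set G}})%type.

Definition subgraph_le (G : sgraph) (S T : subgraph G) : Prop :=
  S.1 \subset T.1 /\ S.2 \subset T.2.

Definition homomorphism (H G : sgraph) (f : H -> G) : Prop :=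
  forall x y, adj x y -> adj (f x) (f y).

Definition image_subgraph (H G : sgraph) (f : H -> G) : subgraph G :=
  ([set f x | x : H], [set f @: e | e : {set H} in edges H]).

Definition zigzag_subgraph (G : sgraph) (S : subgraph G) : Prop :=
  exists2 n, 1 <= n &
    exists f : zigzag n -> G,
      [/\ injective f, homomorphism f & S = image_subgraph f].

Definition maximal_zigzag_subgraph (G : sgraph) (S : subgraph G) : Prop :=
  zigzag_subgraph S /\
  forall T : subgraph G, zigzag_subgraph T -> subgraph_le S T -> T = S.

(* A bijective homomorphism from the chain to [G] exhibits [G] as the chain
   with edges added. *)
Definition two_zigzag_graph (G : sgraph) : Prop :=
  regular4 G /\
  exists k1 k2, [/\ 1 <= k1, 1 <= k2 &
    exists f : closed_chain k1 k2 -> G,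
      [/\ bijective f, homomorphism f,
          maximal_zigzag_subgraph
            (image_subgraph (fun i : zigzag k1 => f (chain_fst k2 i))) &
          maximal_zigzag_subgraph
            (image_subgraph (fun j : zigzag k2 => f (chain_snd k1 j)))]].

Section Labelled.

Variable n : nat.

Definition labelled_adj (E : {set {set 'I_n}}) : rel 'I_n :=
  fun x y => (x != y) && ([set x; y] \in E).

Lemma labelled_adj_sym E : symmetric (labelled_adj E).
Proof. by move=> x y; rewrite /labelled_adj eq_sym setUC. Qed.

Lemma labelled_adj_irr E : irreflexive (labelled_adj E).
Proof. by move=> x; rewrite /labelled_adj eqxx. Qed.

Definition labelled_graph (E : {set {set 'I_n}}) : sgraph :=
  SGraph (labelled_adj_sym E) (labelled_adj_irr E).

End Labelled.

(* The number of isomorphism classes of graphs with n vertices satisfying [P],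
   counted among the graphs on 'I_n. *)
Definition num_iso_classes (P : sgraph -> Prop) (n : nat) : nat :=
  #|equivalence_partition
      (fun E F : {set {set 'I_n}} =>
         `[< iso (labelled_graph E) (labelled_graph F) >])
      [set E : {set {set 'I_n}} |
        [forall e in E, #|e| == 2] && `[< P (labelled_graph E) >]]|.

(* The identity \sum_n c n x^n = p / q of formal power series, i.e. the Cauchy
   product of the series with q is p; c is then unique as soon as q != 0. *)
Definition gen_fun_eq_fraction (c : nat -> nat) (p q : {poly int}) : Prop :=
  forall n, (\sum_(i < n.+1) (c i)%:Z * q`_(n - i) = p`_n)%R.

(* Main.v *)
Require Import Defs.
From HB Require Import structures.
From mathcomp Require Import all_boot all_order all_algebra.
From mathcomp Require Import boolp zify ring.

Set Implicit Arguments.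
Unset Strict Implicit.
Unset Printing Implicit Defensive.

Import GRing.Theory.

(** The level is monotone under double triangle expansion.  An expansion adds
one vertex and always trades one triangle for two; any further loss of
triangles comes from additional common neighbours of the ends of the two
deleted edges, so the level increases by the number of these ([dte_level]).  The descendants
of level at most 2 can therefore be enumerated from [K5].

Up to level 1 they are the squared cycles [circ n], starting with [circ 5],
which is [K5].  An expansion of [circ n] is [circ n.+1] or, for [n >= 7], the
graph [twin n.+1 3] ([circ5_site], [circ6_site], [circ_site_cases]).  Here
[twin n k] is [circ n] with the edges {n-1, 1} and {k, k+2} replaced by
{1, k+2} and {k, n-1}: two zigzags with [k] and [n - k - 2] triangles that
share their end vertices, the neighbours of the ends being joined crosswise.
An expansion of a twin raises the level or lengthens one of the zigzags
([twin_site_cases]).  So the descendants of level 2 are the twins in which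
both zigzags have at least three triangles ([level2_descendantP]).

Such a twin is a completed primitive 2-zigzag graph.  It is internally
6-edge-connected since every descendant is: an expansion never shrinks an edge
cut ([dte_cut_pairs]).  Its two zigzags are maximal because each triangle lies
inside one of them, and consecutive triangles of a zigzag share an edge, which
confines every zigzag subgraph to one of the two ([zigzag_in_zone]).

Conversely, in a 2-zigzag graph the vertices next to the ends of the zigzags
have degree 3 in the chain and the remaining edges match these four vertices.
One of the three matchings prolongs the zigzags, another leaves an edge cut of
size 4, and the third gives a twin, in which a zigzag with fewer than three
triangles would make the other one extendable ([chain_iso_twin]).

Finally, the longest zigzag of [twin n k] has [maxn k (n - k - 2)] triangles,
so twins with [n] vertices are classified by the unordered pair of their
zigzag lengths.  There are [n./2 - 3] such pairs with both entries at least 3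
([num_level2_descendants]), and these numbers have the stated generating
function. *)

(** * Isomorphisms and regularity *)

Lemma iso_refl (G : sgraph) : iso G G.
Proof. by exists id => //; exists id. Qed.

Lemma iso_sym (G H : sgraph) : iso G H -> iso H G.
Proof.
case=> f [g fK gK] fadj; exists g; first by exists f.
by move=> x y; rewrite -fadj !gK.
Qed.

Lemma iso_trans (G H K : sgraph) : iso G H -> iso H K -> iso G K.
Proof.
move=> [f bf fadj] [g bg gadj]; exists (g \o f); first exact: bij_comp.
by move=> x y; rewrite /= gadj fadj.
Qed.

Lemma iso_order (G H : sgraph) : iso G H -> graph_order G = graph_order H.
Proof. by case=> f /bij_eq_card. Qed.

Lemma card_neighbours_image (G H : sgraph) (f : G -> H) (x : G) :
  bijective f -> (forall x y, adj (f x) (f y) = adj x y) ->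
  #|[set y | adj (f x) y]| = #|[set y | adj x y]|.
Proof.
move=> [g fK gK] fadj; rewrite -(card_imset _ (can_inj fK)).
apply: eq_card => y; rewrite inE -[y]gK fadj mem_imset ?inE //; exact: can_inj fK.
Qed.

Lemma iso_regular4 (G H : sgraph) : iso G H -> regular4 G -> regular4 H.
Proof.
move=> [f bf fadj] rG y; case: (bf) => g fK gK.
by rewrite -[y]gK (card_neighbours_image _ bf fadj).
Qed.

Lemma iso_triangles (G H : sgraph) : iso G H -> #|triangles G| = #|triangles H|.
Proof.
move=> [f bf fadj]; case: (bf) => g fK gK.
have fI := can_inj fK.
rewrite -(card_imset _ (imset_inj fI)); apply: eq_card => A.
have -> : A = f @: (g @: A) by rewrite -imset_comp (eq_imset _ gK) imset_id.
rewrite mem_imset; last exact: imset_inj.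
rewrite !inE (card_imset _ fI); congr (_ && _).
apply/forall_inP/forall_inP => hA x.
- move=> /imsetP[x' x'A ->]; apply/forall_inP => y /imsetP[y' y'A ->].
  by rewrite fadj (inj_eq fI); exact: (forall_inP (hA x' x'A)).
- move=> xA; apply/forall_inP => y yA; rewrite -fadj -(inj_eq fI).
  by apply: (forall_inP (hA (f x) _)); exact: imset_f.
Qed.

Lemma iso_level (G H : sgraph) : iso G H -> level G = level H.
Proof. by move=> GH; rewrite /level (iso_order GH) (iso_triangles GH). Qed.

Lemma adj_neq (G : sgraph) (x y : G) : adj x y -> x != y.
Proof. by apply: contraTneq => ->; rewrite adj_irr. Qed.

(** The degrees of the source are at least those of the target, so a
injective homomorphism has no room for additional adjacencies. *)
Lemma homomorphism_adj (H G : sgraph) (f : H -> G) :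
  injective f -> homomorphism f ->
  (forall x : H, 4 <= #|[set y | adj x y]|) -> regular4 G ->
  forall x y, adj (f x) (f y) = adj x y.
Proof.
move=> fI fh dH rG x y; apply/idP/idP; last exact: fh.
have sub : f @: [set y | adj x y] \subset [set y | adj (f x) y].
  by apply/subsetP => w /imsetP[z + ->]; rewrite !inE => /fh.
have E : f @: [set y | adj x y] = [set y | adj (f x) y].
  by apply/eqP; rewrite eqEcard sub rG card_imset // dH.
move=> xy; have : f y \in [set y | adj (f x) y] by rewrite inE.
by rewrite -E mem_imset // inE.
Qed.

Lemma iso_of_homomorphism (H G : sgraph) (f : H -> G) :
  injective f -> #|G| <= #|H| -> homomorphism f ->
  (forall x : H, 4 <= #|[set y | adj x y]|) -> regular4 G -> iso H G.
Proof.
move=> fI cGH fh dH rG; exists f; first exact: inj_card_bij.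
exact: homomorphism_adj.
Qed.

(** Four known neighbours of a vertex are all of them; this is how the degree
hypothesis is used to exclude adjacencies. *)
Lemma neighbours_complete (G : sgraph) (x y : G) (s : seq G) :
  regular4 G -> uniq s -> size s = 4 -> all (adj x) s -> adj x y -> y \in s.
Proof.
move=> rG us ss /allP hs xy.
have E : [set z in s] = [set z | adj x z].
  apply/eqP; rewrite eqEcard rG cardsE (card_uniqP us) ss leqnn andbT.
  by apply/subsetP => z; rewrite !inE => /hs.
have : y \in [set z | adj x z] by rewrite inE.
by rewrite -E inE.
Qed.

Lemma another_neighbour (G : sgraph) (x : G) (s : seq G) :
  regular4 G -> size s < 4 -> exists2 y, adj x y & y \notin s.
Proof.
move=> rG ss.
have : ~~ ([set z | adj x z] \subset [set z in s]).
  apply/negP => /subset_leq_card; rewrite rG cardsE => h.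
  by have := leq_trans h (card_size s); rewrite leqNgt ss.
by case/subsetPn => y; rewrite !inE; exists y.
Qed.

Lemma degree_ge4 (G : sgraph) (x : G) (s : seq G) :
  uniq s -> 4 <= size s -> all (adj x) s -> 4 <= #|[set y | adj x y]|.
Proof.
move=> us ss /allP hs; rewrite (leq_trans ss) // -(card_uniqP us).
by apply: subset_leq_card; apply/subsetP => y /hs; rewrite inE.
Qed.

(** * Double triangle expansion *)

Lemma eq_set2 (T : finType) (a b c d : T) :
  ([set a; b] == [set c; d]) = ((a == c) && (b == d)) || ((a == d) && (b == c)).
Proof.
apply/eqP/idP => [E|].
- have : a \in [set c; d] by rewrite -E set21.
  have : b \in [set c; d] by rewrite -E set22.
  have : c \in [set a; b] by rewrite E set21.
  have : d \in [set a; b] by rewrite E set22.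
  rewrite !inE [c == a]eq_sym [c == b]eq_sym [d == a]eq_sym [d == b]eq_sym.
  by case: (a == c); case: (b == d); case: (a == d); case: (b == c).
- by case/orP => /andP[/eqP-> /eqP->] //; rewrite setUC.
Qed.

Lemma dte_iso (G H : sgraph) (f : G -> H) (v1 v2 v3 v4 : G) :
  bijective f -> (forall x y, adj (f x) (f y) = adj x y) ->
  iso (dte v1 v2 v3 v4) (dte (f v1) (f v2) (f v3) (f v4)).
Proof.
move=> bf fadj; case: (bf) => g fK gK; have fI := can_inj fK.
exists (omap f); first by exists (omap g); case=> //= x; rewrite ?fK ?gK.
by case=> [x|] [y|] //=; rewrite ?fadj ?eq_set2 ?inE !(inj_eq fI).
Qed.

Lemma dte_site_image (G H : sgraph) (f : G -> H) (v1 v2 v3 v4 : G) :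
  bijective f -> (forall x y, adj (f x) (f y) = adj x y) ->
  dte_site v1 v2 v3 v4 -> dte_site (f v1) (f v2) (f v3) (f v4).
Proof.
move=> bf fadj [u [a12 a23 a13] a24].
split; rewrite ?fadj //.
by rewrite -[[:: _; _; _; _]]/(map f [:: v1; v2; v3; v4]) map_inj_uniq //; exact: bij_inj.
Qed.

(** The triangle and the pendant edge of a site do not distinguish [v1] from
[v3]. *)
Lemma dte_swap (G : sgraph) (v1 v2 v3 v4 : G) :
  iso (dte v1 v2 v3 v4) (dte v3 v2 v1 v4).
Proof.
exists id; first by exists id.
case=> [x|] [y|] //=; rewrite ?[[set v3; v1]]setUC // !inE;
by do 4 case: (_ == _).
Qed.

Lemma dte_site_swap (G : sgraph) (v1 v2 v3 v4 : G) :
  dte_site v1 v2 v3 v4 -> dte_site v3 v2 v1 v4.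
Proof.
move=> [u [a12 a23 a13] a24]; split=> //; last by split; rewrite adj_sym.
move: u; rewrite /= !inE !negb_or !andbT [v3 == v2]eq_sym [v3 == v1]eq_sym [v2 == v1]eq_sym.
by do 6 case: (_ == _).
Qed.

Lemma dte_order (G : sgraph) (v1 v2 v3 v4 : G) :
  graph_order (dte v1 v2 v3 v4) = (graph_order G).+1.
Proof. by rewrite /graph_order card_option. Qed.

(** Both orientations of each inequality are recorded, so that the components
can serve as rewriting rules in either direction. *)
Lemma uniq4_neq (T : eqType) (a b c d : T) : uniq [:: a; b; c; d] ->
  [/\ ((a == b) = false) * ((b == a) = false) , ((a == c) = false) * ((c == a) = false),
      ((a == d) = false) * ((d == a) = false) , ((b == c) = false) * ((c == b) = false) &
      (((b == d) = false) * ((d == b) = false)) * (((c == d) = false) * ((d == c) = false))]%type.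
Proof.
rewrite /= !inE !negb_or !andbT => /and3P[/and3P[ab ac ad] /andP[bc bd] cd].
rewrite (eq_sym b a) (eq_sym c a) (eq_sym d a) (eq_sym c b) (eq_sym d b) (eq_sym d c).
by rewrite !(negbTE ab, negbTE ac, negbTE ad, negbTE bc, negbTE bd, negbTE cd).
Qed.

(** Each of [v1], [v2], [v3], [v4] loses the other end of its deleted edge and
gains the new vertex. *)
Lemma dte_regular4 (G : sgraph) (v1 v2 v3 v4 : G) :
  regular4 G -> dte_site v1 v2 v3 v4 -> regular4 (dte v1 v2 v3 v4).
Proof.
move=> rG [u [a12 a23 a13] a24] [x|]; last first.
  have -> : [set y : dte v1 v2 v3 v4 | @adj (dte v1 v2 v3 v4) (@None G) y] =
      Some @: [set z in [:: v1; v2; v3; v4]].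
    apply/setP => -[y|]; rewrite inE /=; last by apply/esym/imsetP => -[].
    by rewrite mem_imset ?inE ?orbA //; exact: Some_inj.
  by rewrite card_imset ?cardsE ?(card_uniqP u) //; exact: Some_inj.
have SI : injective (@Some G) by move=> ? ? [].
have [n12 n13 n14 n23 [n24 n34]] := uniq4_neq u.
have [xv|xv] := boolP (x \in [:: v1; v2; v3; v4]); last first.
  rewrite -(rG x) -(card_imset _ SI); apply: eq_card => -[y|]; rewrite inE /=.
    rewrite (mem_imset _ _ SI) inE !eq_set2.
    by move: xv; rewrite !inE; do 4 case: (x == _); rewrite // andbT.
  rewrite !inE; move: xv; rewrite !inE -!orbA => /negbTE->.
  by apply/esym/imsetP => -[].
(* The other end of the deleted edge at [x]. *)
pose p := if x == v1 then v3 else if x == v3 then v1 else if x == v2 then v4 else v2.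
have [xp pE] : adj x p /\
    forall y, ([set x; y] != [set v1; v3]) && ([set x; y] != [set v2; v4]) = (y != p).
  rewrite /p; move: xv; rewrite !inE => /or4P[] /eqP->;
    (split; last by move=> y;
      rewrite !eq_set2 !(eqxx, n12, n13, n14, n23, n24, n34) /= ?andbT ?orbF ?andTb);
    by rewrite !(eqxx, n12, n13, n14, n23, n24, n34) // adj_sym.
have -> : [set y : dte v1 v2 v3 v4 | @adj (dte v1 v2 v3 v4) (@Some G x) y] =
    None |: Some @: ([set y | adj x y] :\ p).
  apply/setP => -[y|]; rewrite !inE /=; last by move: xv; rewrite !inE -!orbA.
  by rewrite (mem_imset _ _ SI) !inE pE andbC.
rewrite cardsU1 card_imset // (_ : None \notin _); last by apply/imsetP => -[].
by have := rG x; rewrite (cardsD1 p) inE xp.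
Qed.

(** * Triangles and the level *)

Lemma triangle_adj (G : sgraph) (A : {set G}) (x y : G) :
  A \in triangles G -> x \in A -> y \in A -> x != y -> adj x y.
Proof.
rewrite inE => /andP[_ /forall_inP hA] xA yA.
by move/forall_inP: (hA x xA) => /(_ y yA) /implyP.
Qed.

(** From left to right, the three vertices are distinct because the set has
three elements. *)
Lemma trianglesE (G : sgraph) (x a b : G) :
  (x |: [set a; b] \in triangles G) = [&& adj x a, adj x b & adj a b].
Proof.
apply/idP/and3P => [T|[xa xb ab]].
  move: (T); rewrite inE => /andP[/eqP c3 _].
  have [xA aA bA] : [/\ x \in x |: [set a; b], a \in x |: [set a; b]
      & b \in x |: [set a; b]] by rewrite !inE !eqxx !orbT.
  have c := cardsU1 x [set a; b]; rewrite c3 cards2 !inE negb_or in c.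
  have [nxa nxb nab] : [/\ x != a, x != b & a != b].
    by move: c; do 3 case: (_ == _).
  by split; apply: (triangle_adj T).
rewrite inE cardsU1 cards2 !inE (negbTE (adj_neq xa)) (negbTE (adj_neq xb)) adj_neq //=.
apply/forall_inP => y; rewrite !inE => /or3P[] /eqP->;
  apply/forall_inP => z; rewrite !inE => /or3P[] /eqP->;
  by rewrite ?eqxx ?xa ?xb ?ab ?implybT // adj_sym ?xa ?xb ?ab implybT.
Qed.

Definition triangles_through (G : sgraph) (a b : G) : {set {set G}} :=
  [set A in triangles G | (a \in A) && (b \in A)].

Definition common_neighbours (G : sgraph) (a b : G) : {set G} :=
  [set x | adj x a && adj x b].

Lemma in_triangles_through (G : sgraph) (a b : G) (A : {set G}) :
  (A \in triangles_through a b) = (A \in triangles G) && ((a \in A) && (b \in A)).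
Proof. by rewrite /triangles_through in_set. Qed.

Lemma in_common_neighbours (G : sgraph) (a b x : G) :
  (x \in common_neighbours a b) = adj x a && adj x b.
Proof. by rewrite /common_neighbours in_set. Qed.

(** A triangle on an edge is determined by its third vertex. *)
Lemma card_triangles_through (G : sgraph) (a b : G) :
  adj a b -> #|triangles_through a b| = #|common_neighbours a b|.
Proof.
move=> ab; pose t x := x |: [set a; b].
have cnN x : x \in common_neighbours a b -> x \notin [set a; b].
  by rewrite !inE negb_or => /andP[/adj_neq-> /adj_neq->].
have -> : triangles_through a b = t @: common_neighbours a b.
  apply/setP => A; apply/idP/imsetP => [|[x cx ->]]; last first.
    move: cx; rewrite in_common_neighbours in_triangles_through trianglesE !inE.
    by move=> /andP[-> ->]; rewrite ab !eqxx !orbT.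
  rewrite in_triangles_through => /and3P[T aA bA].
  have sub : [set a; b] \subset A by rewrite subUset !sub1set aA.
  have /cards1P[x Ax] : #|A :\: [set a; b]| == 1.
    rewrite cardsD (setIidPr sub) cards2 adj_neq //.
    by move: T; rewrite inE => /andP[/eqP->].
  have At : A = t x by rewrite /t -Ax setUC setDE setUIr setUCr setIT; apply/esym/setUidPr.
  by exists x => //; move: T; rewrite At trianglesE in_common_neighbours => /and3P[-> ->].
apply: card_in_imset => x y /cnN xn /cnN yn E.
have : x \in t y by rewrite -E setU11.
by rewrite in_setU1 (negbTE xn) orbF => /eqP.
Qed.

(** Triangles avoiding the new vertex are the old ones that use neither of the
two deleted edges.  A triangle at the new vertex contains exactly one of [v2]
and [v4], because [v1], [v3] and [v2], [v4] have become non-adjacent.  Those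
through [v4] correspond to the old triangles on [v2], [v4] with third vertex
[v1] or [v3], and those through [v2] are always two. *)
Lemma dte_triangles (G : sgraph) (v1 v2 v3 v4 : G) :
  dte_site v1 v2 v3 v4 ->
  #|triangles (dte v1 v2 v3 v4)| + #|common_neighbours v1 v3 :\ v2|
    + #|common_neighbours v2 v4 :\: [set v1; v3]| = #|triangles G| + 1.
Proof.
move=> [u [a12 a23 a13] a24]; set D := dte _ _ _ _.
have SI : injective (@Some G) by move=> ? ? [].
have [n12 n13 n14 n23 [n24 n34]] := uniq4_neq u.
pose nE := (eqxx, n12, n13, n14, n23, n24, n34).
pose w : D := None; pose s (x : G) : D := Some x.
have sI : injective s by [].
(* The triangles that survive the expansion. *)
pose K := [set A in triangles G | ~~ ((v1 \in A) && (v3 \in A)) && ~~ ((v2 \in A) && (v4 \in A))].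
have TG : #|triangles G| = #|K| + #|triangles_through v1 v3| + #|triangles_through v2 v4|.
  have I0 : triangles_through v1 v3 :&: triangles_through v2 v4 = set0.
    apply/setP => A; rewrite in_setI !in_triangles_through in_set0.
    apply/negP => /andP[/and3P[+ A1 A3] /and3P[_ A2 A4]].
    rewrite inE => /andP[/eqP cA _].
    have /subset_leq_card : [set x in [:: v1; v2; v3; v4]] \subset A.
      by apply/subsetP => x; rewrite !inE => /or4P[] /eqP->.
    by rewrite cA cardsE (card_uniqP u).
  rewrite -addnA -cardsUI I0 cards0 addn0 -cardsUI.
  have -> : K :&: (triangles_through v1 v3 :|: triangles_through v2 v4) = set0.
    by apply/setP => A; rewrite !inE; case: (_ \in A); case: (_ \in A);
      case: (_ \in A); case: (_ \in A); rewrite ?andbF ?andbT ?andbN.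
  rewrite cards0 addn0; apply: eq_card => A.
  rewrite !in_setU !in_triangles_through /K in_set.
  by case: (A \in triangles G) => //=; do 4 case: (_ \in A).
have KE : [set A in triangles D | w \notin A] = (fun A : {set G} => s @: A) @: K.
  apply/setP => A; apply/idP/imsetP => [|[B + ->]].
    rewrite in_set => /andP[TA wA]; pose B := [set x | s x \in A].
    have AB : A = s @: B.
      apply/setP => -[x|]; first by rewrite (mem_imset _ _ sI) inE.
      by rewrite (negbTE wA); apply/esym/imsetP => -[].
    have cB : #|B| = 3.
      by move: TA; rewrite inE AB (card_imset _ sI) => /andP[/eqP].
    exists B => //; rewrite [_ \in K]in_set; apply/and3P; split.
    - rewrite inE cB /=; apply/forall_inP => x; rewrite inE => xA.
      apply/forall_inP => y; rewrite inE => yA; apply/implyP => xy.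
      by have := triangle_adj TA xA yA; rewrite (inj_eq sI) => /(_ xy) /= /and3P[].
    - apply/negP => /andP[]; rewrite !inE => x1 x3.
      by have := triangle_adj TA x1 x3; rewrite (inj_eq sI) nE /= eqxx andbF => /(_ isT).
    - apply/negP => /andP[]; rewrite !inE => x2 x4.
      by have := triangle_adj TA x2 x4; rewrite (inj_eq sI) nE /= eqxx !andbF => /(_ isT).
  rewrite [_ \in K]in_set => /and3P[TB N13 N24]; rewrite in_set; apply/andP; split; last first.
    by apply/imsetP => -[].
  rewrite inE (card_imset _ sI); move: (TB); rewrite inE => /andP[-> _] /=.
  apply/forall_inP => x' /imsetP[x xB ->]; apply/forall_inP => y' /imsetP[y yB ->].
  rewrite (inj_eq sI); apply/implyP => xy; rewrite /= (triangle_adj TB) //=.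
  rewrite !eq_set2; apply/andP; split.
  - by apply: contra N13 => /orP[] /andP[/eqP<- /eqP<-]; rewrite ?xB ?yB.
  - by apply: contra N24 => /orP[] /andP[/eqP<- /eqP<-]; rewrite ?xB ?yB.
have TD : #|triangles D| = #|K| + #|triangles_through w (s v2)| + #|triangles_through w (s v4)|.
  have I0 : triangles_through w (s v2) :&: triangles_through w (s v4) = set0.
    apply/setP => A; rewrite in_setI !in_triangles_through in_set0.
    apply/negP => /andP[/and3P[T _ A2] /and3P[_ _ A4]].
    by have := triangle_adj T A2 A4; rewrite (inj_eq sI) nE /= !eqxx !andbF => /(_ isT).
  rewrite -addnA -cardsUI I0 cards0 addn0 -(cardsID [set A : {set D} | w \in A]) addnC.
  congr (_ + _).
    have imI : injective (fun A : {set G} => s @: A) := imset_inj sI.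
    rewrite -(card_imset _ imI) -KE; apply: eq_card => A.
    by rewrite in_setD in_set [RHS]in_set andbC.
  apply: eq_card => A; rewrite in_setI in_setU !in_triangles_through in_set -!andb_orr.
  apply/andP/and3P => [[T wA]|[T wA _]]; split=> //.
  move: (T); rewrite inE => /andP[/eqP c3 _].
  apply/negPn; rewrite negb_or; apply/negP => /andP[A2 A4].
  have sub : A :\ w \subset [set s v1; s v3].
    apply/subsetP => -[x|]; last by rewrite !inE.
    rewrite in_setD1 /= => xA.
    have := triangle_adj T wA xA isT; rewrite /= !inE (inj_eq sI).
    rewrite -!orbA => /or4P[] /eqP xE; rewrite xE ?eqxx ?orbT //.
      by rewrite -xE xA in A2.
    by rewrite -xE xA in A4.
  have c2 := cardsD1 w A; rewrite c3 wA in c2.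
  have /eqP E : A :\ w == [set s v1; s v3].
    by rewrite eqEcard sub cards2 (inj_eq sI) n13; case: c2; rewrite add0n => <-.
  have /setD1P[_ A1] : s v1 \in A :\ w by rewrite E set21.
  have /setD1P[_ A3] : s v3 \in A :\ w by rewrite E set22.
  by have := triangle_adj T A1 A3; rewrite (inj_eq sI) nE /= eqxx andbF => /(_ isT).
have c13 : #|triangles_through v1 v3| = (#|common_neighbours v1 v3 :\ v2|).+1.
  by rewrite card_triangles_through // (cardsD1 v2) in_common_neighbours adj_sym a12 a23.
have c24 : #|triangles_through v2 v4| = #|common_neighbours v2 v4 :&: [set v1; v3]|
    + #|common_neighbours v2 v4 :\: [set v1; v3]|.
  by rewrite card_triangles_through // cardsID.
have cw2 : #|triangles_through w (s v2)| = 2.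
  rewrite card_triangles_through /= ?inE ?eqxx ?orbT //.
  rewrite (_ : common_neighbours _ _ = s @: [set v1; v3]) ?card_imset ?cards2 ?n13 //.
  apply/setP => -[x|]; last by rewrite in_common_neighbours; apply/esym/imsetP => -[].
  rewrite in_common_neighbours (mem_imset _ _ sI) /= !inE.
  case: (x =P v1) => [->|_]; first by rewrite !eq_set2 a12 !nE.
  case: (x =P v3) => [->|_]; first by rewrite !eq_set2 adj_sym a23 !nE.
  case: (x =P v2) => [->|_]; first by rewrite adj_irr.
  by case: (x =P v4) => [->|_] //; rewrite !eq_set2 !nE !andbF.
have cw4 : #|triangles_through w (s v4)| = #|common_neighbours v2 v4 :&: [set v1; v3]|.
  rewrite card_triangles_through /= ?inE ?eqxx ?orbT //.
  rewrite (_ : common_neighbours _ _ = s @: (common_neighbours v2 v4 :&: [set v1; v3]))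
    ?card_imset //.
  apply/setP => -[x|]; last by rewrite in_common_neighbours; apply/esym/imsetP => -[].
  rewrite in_common_neighbours (mem_imset _ _ sI) in_setI in_common_neighbours /= !inE.
  case: (x =P v1) => [->|_]; first by rewrite !eq_set2 a12 !nE /= ?andbT.
  case: (x =P v3) => [->|_]; first by rewrite !eq_set2 (adj_sym v3 v2) a23 !nE /= ?andbT.
  case: (x =P v2) => [->|_]; first by rewrite !eq_set2 !nE !andbF.
  by case: (x =P v4) => [->|_]; rewrite ?adj_irr ?andbF.
by rewrite TD TG c13 c24 cw2 cw4; lia.
Qed.

(** The increment is a cardinal, hence nonnegative: this is the monotonicity of
the level on which the whole classification rests. *)
Lemma dte_level (G : sgraph) (v1 v2 v3 v4 : G) :
  dte_site v1 v2 v3 v4 ->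
  level (dte v1 v2 v3 v4) =
    (level G + (#|common_neighbours v1 v3 :\ v2|
      + #|common_neighbours v2 v4 :\: [set v1; v3]|)%:Z)%R.
Proof. by move=> /dte_triangles; rewrite /level dte_order; lia. Qed.

(** * Edge connectivity *)

(** Oriented crossing edges; counting pairs instead of edges makes the degree
sum over a vertex set available. *)
Definition cut_pairs (G : sgraph) (A : {set G}) : {set G * G} :=
  [set p | [&& adj p.1 p.2, p.1 \in A & p.2 \notin A]].

(** The form of internal 6-edge-connectivity that is convenient for induction. *)
Definition cuts_ge6 (G : sgraph) : Prop :=
  forall A : {set G}, 1 < #|A| -> 1 < #|~: A| -> 6 <= #|cut_pairs A|.

Lemma card_cut_pairsC (G : sgraph) (A : {set G}) : #|cut_pairs (~: A)| = #|cut_pairs A|.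
Proof.
have sK : involutive (fun p : G * G => (p.2, p.1)) by case.
rewrite -(card_imset _ (inv_inj sK)); apply: eq_card => -[x y].
rewrite -{1}[(x, y)]sK (mem_imset _ _ (inv_inj sK)) !inE /= adj_sym negbK.
by rewrite [_ && (x \in A)]andbC.
Qed.

Lemma cuts_ge6_iso (G H : sgraph) : iso G H -> cuts_ge6 G -> cuts_ge6 H.
Proof.
move=> [f bf fadj] cG B cB cBC; case: (bf) => g fK gK.
have fI := can_inj fK; have gI := can_inj gK.
have cE (C : {set H}) : #|g @: C| = #|C| by rewrite card_imset.
have memg y (C : {set H}) : (g y \in g @: C) = (y \in C) by rewrite mem_imset.
have E : ~: (g @: B) = g @: (~: B).
  by apply/setP => x; rewrite inE -[x]fK !memg inE.
have pI : injective (fun p : G * G => (f p.1, f p.2)).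
  by move=> [x y] [x' y'] [/fI-> /fI->].
have := cG (g @: B); rewrite E !cE => /(_ cB cBC) /leq_trans; apply.
rewrite -(card_imset _ pI) subset_leq_card //; apply/subsetP => _ /imsetP[[x y] + ->].
by rewrite !inE /= fadj -(memg (f x)) -(memg (f y)) !fK.
Qed.

Lemma card_adj_pairs (G : sgraph) (A : {set G}) : regular4 G ->
  #|[set p : G * G | adj p.1 p.2 && (p.1 \in A)]| = 4 * #|A|.
Proof.
move=> rG; transitivity (\sum_(x in A) \sum_(y | adj x y) 1).
  rewrite -sum1dep_card pair_big_dep; apply: eq_bigl => p; exact: andbC.
rewrite mulnC -sum_nat_const; apply: eq_bigr => x _.
by rewrite sum1dep_card.
Qed.

(** The degree sum over [A] counts crossing edges once and inner edges twice. *)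
Lemma card_cut_pairs_split (G : sgraph) (A : {set G}) : regular4 G ->
  4 * #|A| = #|cut_pairs A| + #|[set p | [&& adj p.1 p.2, p.1 \in A & p.2 \in A]]|.
Proof.
move=> rG; rewrite -(card_adj_pairs A rG) -(cardsID [set p | p.2 \in A]) addnC.
by congr (_ + _); apply: eq_card => p; rewrite !inE -?andbA // andbC -andbA.
Qed.

Lemma card_cut_pairs1 (G : sgraph) (x : G) : regular4 G -> #|cut_pairs [set x]| = 4.
Proof.
move=> rG; have := card_cut_pairs_split [set x] rG; rewrite cards1 muln1.
rewrite (_ : [set p | _] = set0) ?cards0 ?addn0 //.
apply/setP => -[a b]; rewrite !inE; apply/negP => /and3P[+ /eqP E1 /eqP E2].
by rewrite /= in E1 E2 *; rewrite E1 E2 adj_irr.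
Qed.

(** Two vertices have degree sum 8, of which an edge between them uses 2. *)
Lemma card_cut_pairs2 (G : sgraph) (x y : G) :
  regular4 G -> x != y -> 6 <= #|cut_pairs [set x; y]|.
Proof.
move=> rG xy; have := card_cut_pairs_split [set x; y] rG; rewrite cards2 xy.
suff : #|[set p | [&& adj p.1 p.2, p.1 \in [set x; y] & p.2 \in [set x; y]]]| <= 2 by lia.
have : #|[set (x, y); (y, x)]| <= 2 by rewrite cards2; case: (_ != _).
apply: leq_trans; apply: subset_leq_card; apply/subsetP => -[a b]; rewrite !inE /=.
by case/and3P => + /orP[]/eqP E1 /orP[]/eqP E2; rewrite E1 E2 ?adj_irr ?eqxx ?orbT.
Qed.

Lemma cuts_ge6_K5 : cuts_ge6 (complete_graph 5).
Proof.
move=> A A2 B2.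
have -> : cut_pairs A = setX A (~: A).
  apply/setP => -[x y]; rewrite !inE /=.
  by apply/and3P/andP => [[]|[xA yA]] //; split=> //; apply: contraNneq yA => <-.
rewrite cardsX; have := cardsC A; rewrite card_ord => c5.
by move: A2 B2 c5; case: #|A| => [|[|[|[|[]]]]]; lia.
Qed.

(** A cut of the expansion is at least as large as the cut it induces on the
old vertices: when a deleted edge crossed the latter, its end on the side
away from the new vertex is joined to the new vertex. *)
Lemma dte_cut_pairs (G : sgraph) (v1 v2 v3 v4 : G) (A : {set G}) :
  dte_site v1 v2 v3 v4 ->
  #|cut_pairs A| <= #|@cut_pairs (dte v1 v2 v3 v4) (Some @: A)|.
Proof.
move=> [u _ _]; have [n12 n13 n14 n23 [n24 n34]] := uniq4_neq u.
have SI : injective (@Some G) by move=> ? ? [].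
(* A deleted crossing edge is replaced by the edge from its end in [A] to the
   new vertex. *)
pose del (p : G * G) := ([set p.1; p.2] == [set v1; v3]) || ([set p.1; p.2] == [set v2; v4]).
pose h (p : G * G) : option G * option G :=
  (Some p.1, if del p then None else Some p.2).
have hI : injective h.
  move=> [x y] [x' y'] [<-]; rewrite /del /= !eq_set2.
  case: ifP => d; case: ifP => d' //; last by case=> ->.
  move=> _; move: d; rewrite -orbA => /or4P[] /andP[/eqP ex /eqP ->];
  by move: d'; rewrite ex -orbA !(eqxx, n12, n13, n14, n23, n24, n34) /= ?orbF ?andbF => /eqP->.
rewrite -(card_imset _ hI); apply: subset_leq_card; apply/subsetP => _ /imsetP[[x y] + ->].
rewrite !inE /= (mem_imset _ _ SI) => /and3P[xy -> yA].
rewrite /h /=; case: ifP => [d|/negbT]; last first.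
  by rewrite negb_or (mem_imset _ _ SI) yA => /andP[-> ->]; rewrite xy.
apply/andP; split; last by apply/imsetP => -[].
move: d; rewrite /del /= !eq_set2 !inE -orbA.
by case/or4P => /andP[/eqP-> _]; rewrite eqxx ?orbT.
Qed.

(** If the old vertices on the side of the new vertex number at least two, the
induced cut of the old graph gives the bound; otherwise that side consists of
two vertices. *)
Lemma dte_cuts_ge6 (G : sgraph) (v1 v2 v3 v4 : G) :
  regular4 G -> dte_site v1 v2 v3 v4 -> cuts_ge6 G -> cuts_ge6 (dte v1 v2 v3 v4).
Proof.
move=> rG st cG; set D := dte _ _ _ _; pose w : D := None.
have SI : injective (@Some G) by move=> ? ? [].
have rD : regular4 D by apply: dte_regular4.
suff H (B : {set D}) : w \notin B -> 1 < #|B| -> 1 < #|~: B| -> 6 <= #|cut_pairs B|.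
  move=> B B2 C2; have [wB|wB] := boolP (w \in B); last exact: H.
  by rewrite -card_cut_pairsC H // ?inE ?negbK // setCK.
move=> wB B2 C2; pose A : {set G} := [set x | (Some x : D) \in B].
have BE : B = Some @: A.
  apply/setP => -[x|]; first by rewrite (mem_imset _ _ SI) inE.
  by rewrite (negbTE wB); apply/esym/imsetP => -[].
have cA : #|A| = #|B| by rewrite BE card_imset.
have CE : ~: B = w |: Some @: (~: A).
  apply/setP => -[x|]; rewrite !inE /=; last by rewrite wB.
  by rewrite (mem_imset _ _ SI) !inE.
have cC : #|~: B| = (#|~: A|).+1.
  rewrite CE cardsU1 card_imset // (_ : w \notin _) //.
  by apply/imsetP => -[].
have [C1|] := ltnP 1 #|~: A|.
  rewrite BE; apply: leq_trans (dte_cut_pairs _ st).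
  by apply: cG => //; rewrite cA.
rewrite cC in C2; move=> C1; have /cards1P[x xE] : #|~: A| == 1 by rewrite eqn_leq C1.
rewrite -card_cut_pairsC CE xE imset_set1.
exact: card_cut_pairs2.
Qed.

Lemma regular4_order (G : sgraph) (x : G) : regular4 G -> 5 <= #|G|.
Proof.
move=> rG; have := subset_leq_card (subsetT (x |: [set y | adj x y])).
by rewrite cardsT cardsU1 rG inE adj_irr.
Qed.

Lemma remove_edges_sym (G : sgraph) (F : {set {set G}}) : symmetric (remove_edges F).
Proof. by move=> x y; rewrite /remove_edges adj_sym setUC. Qed.

(** Every edge leaving a union of components of the remaining graph has been
removed. *)
Lemma card_cut_pairs_removed (G : sgraph) (F : {set {set G}}) (A : {set G}) :
  closed (remove_edges F) A -> #|cut_pairs A| <= #|F|.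
Proof.
move=> cA; have inj : {in cut_pairs A &, injective (fun p : G * G => [set p.1; p.2])}.
  move=> [x y] [x' y']; rewrite !inE /= => /and3P[_ xA yA] /and3P[_ xA' yA'] /eqP.
  rewrite eq_set2 => /orP[] /andP[/eqP ex /eqP ey]; first by rewrite ex ey.
  by rewrite -ex xA in yA'.
rewrite -(card_in_imset inj); apply: subset_leq_card; apply/subsetP => _ /imsetP[[x y] + ->].
rewrite !inE /= => /and3P[xy xA yA]; apply: contraTT yA => nF; rewrite negbK.
by rewrite -(cA x y) //; rewrite /remove_edges xy.
Qed.

Lemma closed_component (T : finType) (e : rel T) (x : T) :
  connect_sym e -> closed e [set y | connect e x y].
Proof.
move=> sym a b ab; rewrite !inE; apply/idP/idP => h; apply: (connect_trans h);
  by [exact: connect1|rewrite sym; exact: connect1].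
Qed.

(** A component left after removing at most five edges, or its complement, is a
single vertex [v].  The rest stays connected: an isolated vertex [x] other than
[v] would make [[set v; x]] a union of components with at least two vertices on
either side. *)
Lemma internally_6_of_cuts (G : sgraph) : regular4 G -> 0 < #|G| ->
  cuts_ge6 G -> internally_6_edge_connected G.
Proof.
move=> rG /card_gt0P[x0 _] cG; have c5 := regular4_order x0 rG.
have sym F : connect_sym (@remove_edges G F) := sym_connect_sym (@remove_edges_sym G F).
have cl F (A : {set G}) : closed (remove_edges F) A -> #|F| <= 5 -> #|A| <= 1 \/ #|~: A| <= 1.
  move=> cA cF; have [|A2] := leqP #|A| 1; first by left.
  have [|C2] := leqP #|~: A| 1; first by right.
  by have := leq_trans (cG A A2 C2) (leq_trans (card_cut_pairs_removed cA) cF).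
have single (A : {set G}) x y : #|A| <= 1 -> x \in A -> y \in A -> x = y.
  by move/card_le1_eqP => h xA yA; apply: h.
pose isolated (F : {set {set G}}) (v : G) := forall z, connect (remove_edges F) v z -> z = v.
have comp (F : {set {set G}}) (x : G) : #|F| <= 5 -> isolated F x \/
    (forall y z, ~~ connect (remove_edges F) x y -> ~~ connect (remove_edges F) x z -> y = z).
  move=> cF; have [C1|C1] := cl F _ (closed_component x (sym F)) cF; [left|right].
    by move=> z xz; apply: (single _ _ _ C1); rewrite inE.
  by move=> y z xy xz; apply: (single _ _ _ C1); rewrite !inE.
have exists_isolated (F : {set {set G}}) (x y : G) : #|F| <= 5 -> ~~ connect (remove_edges F) x y ->
    exists v, isolated F v.
  move=> cF xy; have [ix|h] := comp F x cF; first by exists x.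
  exists y => z yz; apply: h => //; apply: contra xy => xz.
  by rewrite (connect_trans xz) // sym.
have rest (F : {set {set G}}) (v x y : G) : #|F| <= 5 -> isolated F v -> x != v -> y != v ->
    connect (remove_edges F) x y.
  move=> cF iv xv yv; apply/negPn/negP => xy.
  have vx : ~~ connect (remove_edges F) x v.
    by rewrite sym; apply/negP => /iv xE; rewrite xE eqxx in xv.
  have [ix|h] := comp F x cF; last by rewrite (h _ _ xy vx) eqxx in yv.
  have cvx : closed (remove_edges F) [set v; x].
    move=> a b ab; rewrite !inE; have ab' := connect1 ab; have ba' := ab'; rewrite sym in ba'.
    apply/orP/orP => -[] /eqP E; subst.
    - by left; apply/eqP/iv.
    - by right; apply/eqP/ix.
    - by left; apply/eqP/iv.
    - by right; apply/eqP/ix.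
  have := cardsC [set v; x]; rewrite cards2 eq_sym xv => cE.
  by have [] := cl F _ cvx cF; [rewrite cards2 eq_sym xv|lia].
have notconn (F : {set {set G}}) : ~ connected_rel (remove_edges F) ->
    exists x y, ~~ connect (remove_edges F) x y.
  move=> nc; apply: contrapT => h; apply: nc; split; first by apply/card_gt0P; exists x0.
  by move=> x y; apply/negPn/negP => xy; apply: h; exists x, y.
split.
  have eq0 : @remove_edges G set0 =2 @adj G by move=> x y; rewrite /remove_edges inE andbT.
  apply: contrapT => nc.
  have /notconn[x [y xy]] : ~ connected_rel (@remove_edges G set0).
    by move=> [c0 h]; apply: nc; split=> // x y; rewrite -(eq_connect eq0).
  have [|v iv] := exists_isolated set0 _ _ _ xy; first by rewrite cards0.
  have : closed (@remove_edges G set0) [set v].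
    move=> a b ab; rewrite !inE; have ab' := connect1 ab; have ba' := ab'; rewrite sym in ba'.
    by apply/eqP/eqP => E; subst; apply: iv.
  by move/card_cut_pairs_removed; rewrite card_cut_pairs1 // cards0.
move=> F _ cF /notconn[x [y /(exists_isolated F _ _ cF)[v iv]]]; exists v => a b.
have [->|av] := eqVneq a v.
  by apply/idP/eqP => [/iv-> | /esym/eqP->]; rewrite ?eqxx ?connect0.
have [->|bv] := eqVneq b v; last by rewrite (rest F v).
by rewrite sym; apply/negP => /iv E; rewrite E eqxx in av.
Qed.

(** * Graphs on initial segments of the natural numbers *)

(** Adjacency in the graphs below is a disjunction of linear conditions.  These
tactics split hypotheses and goal into their linear atoms before calling [lia],
which is much faster than submitting the whole boolean formula; [solveb] tries
a single disjunct first and the whole disjunction only as a last resort. *)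
Ltac splitb := repeat match goal with
 | H : is_true (_ || _) |- _ => case/orP: H => H
 | H : is_true (_ && _) |- _ => let H' := fresh in case/andP: H => H' H
 | H : is_true (?x == _) |- _ => move/eqP: H => H; try subst x
 end.
Ltac solveb := lazymatch goal with
 | |- is_true (_ && _) => apply/andP; split; solveb
 | |- is_true (_ || _) => first [apply/orP; left; solveb | apply/orP; right; solveb | lia]
 | |- _ => lia end.
Ltac splitif := repeat match goal with
 | |- context [if ?b then _ else _] => let E := fresh in case E : b
 | _ : context [if ?b then _ else _] |- _ => let E := fresh in case E : b in *
 end.
Ltac casework := splitb; splitif; first [exfalso; lia | solveb | lia].

Section NatGraph.
Variables (n : nat) (r : rel nat).

Definition nat_adj (i j : 'I_n) : bool := (i != j) && (r i j || r j i).

Lemma nat_adj_sym : symmetric nat_adj.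
Proof. by move=> i j; rewrite /nat_adj eq_sym orbC. Qed.

Lemma nat_adj_irr : irreflexive nat_adj.
Proof. by move=> i; rewrite /nat_adj eqxx. Qed.

Definition nat_graph : sgraph := SGraph nat_adj_sym nat_adj_irr.

Definition min_degree4 : Prop := forall i : nat_graph, 4 <= #|[set j | adj i j]|.

End NatGraph.

Lemma nat_degree_ge4 (n : nat) (r : rel nat) (i : nat_graph n r) (s : seq nat) :
  uniq s -> size s = 4 ->
  all (fun j => [&& j < n, j != i & r i j || r j i]) s ->
  4 <= #|[set j | adj i j]|.
Proof.
move=> us ss hs; apply: (@degree_ge4 (nat_graph n r) i (pmap insub s)).
- exact: pmap_sub_uniq.
- rewrite size_pmap_sub -ss -(eq_in_count (a1 := xpredT)) ?count_predT //.
  by move=> j /(allP hs) /and3P[-> _ _].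
- apply/allP => j; rewrite mem_pmap_sub => /(allP hs) /and3P[_ ji rij].
  by rewrite /= /nat_adj rij andbT eq_sym -val_eqE.
Qed.

(** Checking adjacency in one direction suffices by regularity, and it can be
done on natural numbers. *)
Lemma relabel_iso (n : nat) (r r' : rel nat) (s : nat -> nat) :
  min_degree4 n r -> regular4 (nat_graph n r') ->
  (forall i, i < n -> s i < n) ->
  (forall i j, i < n -> j < n -> s i = s j -> i = j) ->
  (forall i j, i < n -> j < n -> r i j -> r' (s i) (s j) || r' (s j) (s i)) ->
  exists f : nat_graph n r -> nat_graph n r',
    [/\ bijective f, forall x y, adj (f x) (f y) = adj x y & forall i : 'I_n, f i = s i :> nat].
Proof.
move=> dr rr' sn sI sr; pose f (i : 'I_n) : 'I_n := Ordinal (sn i (ltn_ord i)).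
have fI : injective f.
  by move=> i j /(congr1 val) /= /(sI _ _ (ltn_ord i) (ltn_ord j)) /val_inj.
have bf : bijective f by apply: injF_bij.
have fh : @homomorphism (nat_graph n r) (nat_graph n r') f.
  move=> i j /andP[ij rij]; rewrite /= /nat_adj (inj_eq fI) ij /=.
  by case/orP: rij => h; [|rewrite orbC]; apply: sr.
by exists f; split=> //; apply: homomorphism_adj.
Qed.

(** To recognise an expansion, [p] is the number of the new vertex in the target
and [s] gives the old number of every other vertex of the target.  The last two
hypotheses say that adjacent pairs of the target are old edges that are not
deleted, or join the new vertex to the site. *)
Lemma expansion_iso (n p : nat) (r r' : rel nat) (s : nat -> nat)
    (v1 v2 v3 v4 : nat_graph n r) :
  min_degree4 n.+1 r' -> regular4 (dte v1 v2 v3 v4) ->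
  (forall i, i < n.+1 -> i != p -> s i < n) ->
  (forall i j, i < n.+1 -> j < n.+1 -> i != p -> j != p -> s i = s j -> i = j) ->
  (forall i j, i < n.+1 -> j < n.+1 -> i != p -> j != p -> r' i j ->
    [&& r (s i) (s j) || r (s j) (s i),
      (s i != v1) || (s j != v3), (s i != v3) || (s j != v1),
      (s i != v2) || (s j != v4) & (s i != v4) || (s j != v2)]) ->
  (forall j, j < n.+1 -> j != p -> r' p j || r' j p ->
    [|| s j == v1, s j == v2, s j == v3 | s j == v4]) ->
  iso (nat_graph n.+1 r') (dte v1 v2 v3 v4).
Proof.
move=> dr rD sn sI sr sp.
pose f (i : 'I_n.+1) : option 'I_n := if i == p :> nat then None else insub (s i).
have fp (i : 'I_n.+1) : i != p :> nat -> exists2 k : 'I_n, f i = Some k & k = s i :> nat.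
  move=> ip; have h := sn _ (ltn_ord i) ip; exists (Ordinal h) => //.
  by rewrite /f (negbTE ip) insubT.
have fp' (i : 'I_n.+1) : i = p :> nat -> f i = None by rewrite /f => ->; rewrite eqxx.
have fI : injective f.
  move=> i j; have [ip|ip] := eqVneq (i : nat) p.
    rewrite (fp' i ip); have [jp _|/fp[k -> _] //] := eqVneq (j : nat) p.
    by apply: val_inj; rewrite /= ip jp.
  have [jp|jp] := eqVneq (j : nat) p; first by rewrite (fp' j jp); case: (fp i ip) => k ->.
  case: (fp i ip) => k -> ks; case: (fp j jp) => k' -> ks' [kk].
  by apply/val_inj/(sI _ _ (ltn_ord i) (ltn_ord j) ip jp); rewrite -ks -ks' kk.
have half (i j : 'I_n.+1) : i != j -> r' i j -> @adj (dte v1 v2 v3 v4) (f i) (f j).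
  move=> ij rij; have [ip|ip] := eqVneq (i : nat) p.
    have jp : j != p :> nat by rewrite -ip eq_sym.
    rewrite (fp' i ip); case: (fp j jp) => k -> ks /=.
    by rewrite !inE -!orbA -!val_eqE /= ks; apply: sp; rewrite // -ip rij.
  have [jp|jp] := eqVneq (j : nat) p.
    rewrite (fp' j jp); case: (fp i ip) => k -> ks /=.
    by rewrite !inE -!orbA -!val_eqE /= ks; apply: sp; rewrite // -jp rij orbT.
  case: (fp i ip) => k fik ks; case: (fp j jp) => l fjl ls; rewrite fik fjl /=.
  have kl : k != l by apply: contraNneq ij => kl; apply/eqP/fI; rewrite fik fjl kl.
  have := sr _ _ (ltn_ord i) (ltn_ord j) ip jp rij; rewrite -ks -ls.
  rewrite /nat_adj kl !eq_set2 -!val_eqE /= => /and5P[-> h1 h2 h3 h4].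
  by rewrite /= !negb_or !negb_and h1 h2 h3 h4.
apply: (@iso_of_homomorphism (nat_graph n.+1 r') (dte v1 v2 v3 v4) f) => //.
  by rewrite card_option !card_ord.
move=> i j /andP[ij /orP[] h]; first exact: half.
by rewrite adj_sym half // eq_sym.
Qed.

(** * The squares of cycles *)

(** Distance 1 or 2 modulo [n].  Each pair is given in increasing order, which
avoids modular arithmetic. *)
Definition circ_rel (n i j : nat) : bool :=
  [|| j == i.+1, j == i.+2, (i == 0) && (j.+1 == n), (i == 0) && (j.+2 == n)
    | (i == 1) && (j.+1 == n)].

Definition circ (n : nat) : sgraph := nat_graph n (circ_rel n).

Lemma circ_min_degree4 n : 5 <= n -> min_degree4 n (circ_rel n).
Proof.
move=> n5 i; have := ltn_ord i; set k := (i : nat) => kn.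
apply: (nat_degree_ge4 (s := [:: if k.+1 < n then k.+1 else 0;
   if k.+2 < n then k.+2 else k.+2 - n; if 0 < k then k.-1 else n.-1;
   if 1 < k then k.-2 else n + k - 2])) => //.
  rewrite /= !inE !negb_or; splitif; solveb.
rewrite -/k /circ_rel /=; splitif; solveb.
Qed.

Lemma card_adj_complete (x : complete_graph 5) : #|[set y | adj x y]| = 4.
Proof.
rewrite (_ : [set y | adj x y] = [set~ x]); last by apply/setP => y; rewrite !inE /= eq_sym.
by rewrite cardsC1 card_ord.
Qed.

Lemma K5_descendant_regular4 (G : sgraph) : K5_descendant G -> regular4 G.
Proof.
elim=> {G} [|G v1 v2 v3 v4 _ _ rG st|G H _ rG GH]; first exact: card_adj_complete.
- exact: dte_regular4.
- exact: iso_regular4 rG.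
Qed.

Lemma K5_descendant_step (G H : sgraph) (v1 v2 v3 v4 : G) :
  K5_descendant G -> dte_site v1 v2 v3 v4 -> iso H (dte v1 v2 v3 v4) -> K5_descendant H.
Proof.
move=> dG st /iso_sym; apply: K5_descendant_iso; apply: K5_descendant_dte => //.
exact: K5_descendant_regular4.
Qed.

(** The new vertex is inserted between [2] and [3]. *)
Lemma circ_expansion (n : nat) (v1 v2 v3 v4 : circ n) :
  5 <= n -> regular4 (circ n) -> dte_site v1 v2 v3 v4 ->
  v1 = 1 :> nat -> v2 = 2 :> nat -> v3 = 3 :> nat -> v4 = 4 :> nat ->
  iso (circ n.+1) (dte v1 v2 v3 v4).
Proof.
move=> n5 rG st e1 e2 e3 e4.
apply: (@expansion_iso n 3 _ _ (fun i => if i < 3 then i else i.-1)).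
- by apply: circ_min_degree4; lia.
- exact: dte_regular4.
- move=> i; splitif; lia.
- move=> i j; splitif; lia.
- move=> i j hi hj ip jp h; rewrite e1 e2 e3 e4; rewrite /circ_rel in h *.
  casework.
- move=> j hj jp h; rewrite e1 e2 e3 e4; rewrite /circ_rel in h *.
  casework.
Qed.

(** The new vertex is inserted between [1] and [2]. *)
Lemma circ_expansion0 (n : nat) (v1 v2 v3 v4 : circ n) :
  5 <= n -> regular4 (circ n) -> dte_site v1 v2 v3 v4 ->
  v1 = 1 :> nat -> v2 = 2 :> nat -> v3 = 3 :> nat -> v4 = 0 :> nat ->
  iso (circ n.+1) (dte v1 v2 v3 v4).
Proof.
move=> n5 rG st e1 e2 e3 e4.
apply: (@expansion_iso n 2 _ _ (fun i => if i < 2 then i else i.-1)).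
- by apply: circ_min_degree4; lia.
- exact: dte_regular4.
- move=> i; splitif; lia.
- move=> i j; splitif; lia.
- move=> i j hi hj ip jp h; rewrite e1 e2 e3 e4; rewrite /circ_rel in h *.
  casework.
- move=> j hj jp h; rewrite e1 e2 e3 e4; rewrite /circ_rel in h *.
  casework.
Qed.

(** Two zigzags, running through [0], [1], up to [k.+1] and through [k.+1],
[k.+2], up to [n.-1] and back to [0].  The neighbours [1] and [k] of the ends in
the first are joined crosswise to [k.+2] and [n.-1], the neighbours of the
opposite ends in the second. *)
Definition twin_rel (n k i j : nat) : bool :=
  [|| j == i.+1, (j == i.+2) && (i != k), (i == 0) && (j.+1 == n),
      (i == 0) && (j.+2 == n), (i == 1) && (j == k.+2) | (i == k) && (j.+1 == n)].

Definition twin (n k : nat) : sgraph := nat_graph n (twin_rel n k).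

Lemma twin_min_degree4 n k : 3 <= k -> k + 5 <= n -> min_degree4 n (twin_rel n k).
Proof.
move=> k3 kn i; have := ltn_ord i; set m := (i : nat) => mn.
apply: (nat_degree_ge4 (s := [:: if m.+1 < n then m.+1 else 0;
   if m == k then n.-1 else if m.+1 == n then k else if m.+2 < n then m.+2 else m.+2 - n;
   if 0 < m then m.-1 else n.-1;
   if m == 1 then k.+2 else if m == k.+2 then 1 else
   if 1 < m then m.-2 else n + m - 2])) => //.
  rewrite /= !inE !negb_or; splitif; solveb.
rewrite -/m /twin_rel /=; splitif; solveb.
Qed.

(** Writing [w] for the new vertex, the expansion contains the zigzag
[0], [2], [w], [1], [3] with three triangles, and the untouched part of the
squared cycle is the second zigzag, from [3] to [n.-1] and back to [0]. *)
Lemma circ_twin_expansion3 (n : nat) (v1 v2 v3 v4 : circ n) :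
  7 <= n -> regular4 (circ n) -> dte_site v1 v2 v3 v4 ->
  v1 = 1 :> nat -> v2 = 2 :> nat -> v3 = 0 :> nat -> v4 = 3 :> nat ->
  iso (twin n.+1 3) (dte v1 v2 v3 v4).
Proof.
move=> n7 rG st e1 e2 e3 e4.
apply: (@expansion_iso n 2 _ _ (fun i => if i == 0 then 0 else if i == 1 then 2 else
  if i == 3 then 1 else i.-1)).
- by apply: twin_min_degree4; lia.
- exact: dte_regular4.
- move=> i; splitif; lia.
- move=> i j; splitif; lia.
- move=> i j hi hj ip jp h; rewrite e1 e2 e3 e4; rewrite /twin_rel /circ_rel in h *.
  casework.
- move=> j hj jp h; rewrite e1 e2 e3 e4; rewrite /twin_rel in h *.
  casework.
Qed.

(** The zigzag with three triangles is now [0], [w], [2], [1], [3]. *)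
Lemma circ_twin_expansion4 (n : nat) (v1 v2 v3 v4 : circ n) :
  7 <= n -> regular4 (circ n) -> dte_site v1 v2 v3 v4 ->
  v1 = 1 :> nat -> v2 = 2 :> nat -> v3 = 0 :> nat -> v4 = 4 :> nat ->
  iso (twin n.+1 3) (dte v1 v2 v3 v4).
Proof.
move=> n7 rG st e1 e2 e3 e4.
apply: (@expansion_iso n 1 _ _ (fun i => if i == 0 then 0 else if i == 2 then 2 else
  if i == 3 then 1 else i.-1)).
- by apply: twin_min_degree4; lia.
- exact: dte_regular4.
- move=> i; splitif; lia.
- move=> i j; splitif; lia.
- move=> i j hi hj ip jp h; rewrite e1 e2 e3 e4; rewrite /twin_rel /circ_rel in h *.
  casework.
- move=> j hj jp h; rewrite e1 e2 e3 e4; rewrite /twin_rel in h *.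
  casework.
Qed.

Lemma circ_rotation (n d : nat) : 5 <= n -> d < n -> regular4 (circ n) ->
  exists f : circ n -> circ n, [/\ bijective f, forall x y, adj (f x) (f y) = adj x y
    & forall i : 'I_n, f i = (if i + d < n then i + d else i + d - n) :> nat].
Proof.
move=> n5 dn rG.
apply: (relabel_iso (s := fun i => if i + d < n then i + d else i + d - n)) => //.
- exact: circ_min_degree4.
- move=> i; splitif; lia.
- move=> i j; splitif; lia.
- move=> i j hi hj h; rewrite /circ_rel in h *; casework.
Qed.

Lemma circ_reflection (n : nat) : 5 <= n -> regular4 (circ n) ->
  exists f : circ n -> circ n, [/\ bijective f, forall x y, adj (f x) (f y) = adj x y
    & forall i : 'I_n, f i = (if i <= 4 then 4 - i else n + 4 - i) :> nat].
Proof.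
move=> n5 rG.
apply: (relabel_iso (s := fun i => if i <= 4 then 4 - i else n + 4 - i)) => //.
- exact: circ_min_degree4.
- move=> i; splitif; lia.
- move=> i j; splitif; lia.
- move=> i j hi hj h; rewrite /circ_rel in h *; casework.
Qed.

Lemma circ_site_center (n : nat) (v1 v2 v3 v4 : circ n) :
  5 <= n -> regular4 (circ n) -> dte_site v1 v2 v3 v4 ->
  exists w1 w2 w3 w4 : circ n,
    [/\ w2 = 2 :> nat, dte_site w1 w2 w3 w4 &
        iso (dte v1 v2 v3 v4) (dte w1 w2 w3 w4)].
Proof.
move=> n5 rG st.
have [d dn dE] : exists2 d, d < n & (if v2 + d < n then v2 + d else v2 + d - n) = 2.
  have := ltn_ord v2; move: (nat_of_ord v2) => k kn.
  by case: (leqP k 2) => k2; [exists (2 - k)|exists (n + 2 - k)]; splitif; lia.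
have [f [bf fadj fE]] := circ_rotation n5 dn rG.
exists (f v1), (f v2), (f v3), (f v4); split.
- by rewrite fE.
- exact: dte_site_image.
- exact: dte_iso.
Qed.

(** [circ 6] is the octahedron, with antipodal pairs [a], [a + 3]. *)
Lemma circ6_swap (a : nat) : a < 3 -> regular4 (circ 6) ->
  exists f : circ 6 -> circ 6, [/\ bijective f, forall x y, adj (f x) (f y) = adj x y
    & forall i : 'I_6, f i = (if i == a :> nat then a + 3
        else if i == a + 3 :> nat then a else i) :> nat].
Proof.
move=> a3 rG.
apply: (relabel_iso (s := fun i => if i == a then a + 3 else if i == a + 3 then a else i)) => //.
- exact: circ_min_degree4.
- move=> i; splitif; lia.
- move=> i j; splitif; lia.
- move=> i j hi hj h; rewrite /circ_rel in h *; casework.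
Qed.

Lemma circ_center_cycle (n : nat) (v1 v2 v3 v4 : circ n) :
  5 <= n -> regular4 (circ n) -> dte_site v1 v2 v3 v4 -> v2 = 2 :> nat ->
  ((v1 == 1 :> nat) && (v3 == 3 :> nat)) || ((v1 == 3 :> nat) && (v3 == 1 :> nat)) ->
  (v4 == 0 :> nat) || (v4 == 4 :> nat) ->
  iso (circ n.+1) (dte v1 v2 v3 v4).
Proof.
move=> n5 rG; wlog [e1 e3] : v1 v3 / (v1 = 1 :> nat) /\ (v3 = 3 :> nat).
  move=> H st e2 /orP[] /andP[/eqP e1 /eqP e3] e4.
    by apply: H => //; rewrite e1 e3.
  apply: iso_trans (dte_swap _ _ _ _); apply: H => //; first exact: dte_site_swap.
  by rewrite e1 e3.
move=> st e2 _ /orP[] /eqP e4; [exact: circ_expansion0 | exact: circ_expansion].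
Qed.

Lemma circ_center_twin (n : nat) (v1 v2 v3 v4 : circ n) :
  7 <= n -> regular4 (circ n) -> dte_site v1 v2 v3 v4 -> v2 = 2 :> nat ->
  ((v1 == 1 :> nat) && (v3 == 0 :> nat)) || ((v1 == 0 :> nat) && (v3 == 1 :> nat)) ->
  (v4 == 3 :> nat) || (v4 == 4 :> nat) ->
  iso (twin n.+1 3) (dte v1 v2 v3 v4).
Proof.
move=> n5 rG; wlog [e1 e3] : v1 v3 / (v1 = 1 :> nat) /\ (v3 = 0 :> nat).
  move=> H st e2 /orP[] /andP[/eqP e1 /eqP e3] e4.
    by apply: H => //; rewrite e1 e3.
  apply: iso_trans (dte_swap _ _ _ _); apply: H => //; first exact: dte_site_swap.
  by rewrite e1 e3.
move=> st e2 _ /orP[] /eqP e4; [exact: circ_twin_expansion3 | exact: circ_twin_expansion4].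
Qed.

Lemma circ_center_neighbour (n : nat) (v x : circ n) :
  5 <= n -> v = 2 :> nat -> adj v x ->
  [|| x == 0 :> nat, x == 1 :> nat, x == 3 :> nat | x == 4 :> nat].
Proof.
move=> n5 e /andP[_]; have := ltn_ord x; rewrite e /circ_rel => xn h.
by splitb; lia.
Qed.

(** With [v2] moved to [2], its neighbours are [0], [1], [3], [4].  Since
[n >= 7], the edges among them are {0, 1}, {1, 3} and {3, 4}.  The middle one
continues the squared cycle, and the other two are exchanged by the reflection
fixing [2]. *)
Lemma circ_site_cases (n : nat) (v1 v2 v3 v4 : circ n) :
  7 <= n -> regular4 (circ n) -> dte_site v1 v2 v3 v4 ->
  iso (circ n.+1) (dte v1 v2 v3 v4) \/ iso (twin n.+1 3) (dte v1 v2 v3 v4).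
Proof.
move=> n7 rG st; have n5 : 5 <= n by lia.
have [w1 [w2 [w3 [w4 [e2 {}st /iso_sym wv]]]]] := circ_site_center n5 rG st.
suff [h|h] : iso (circ n.+1) (dte w1 w2 w3 w4) \/ iso (twin n.+1 3) (dte w1 w2 w3 w4).
- by left; apply: iso_trans wv.
- by right; apply: iso_trans wv.
move: {v1 v2 v3 v4 wv} (st) => [u [a12 a23 a13] a24].
have c1 : [|| w1 == 0 :> nat, w1 == 1 :> nat, w1 == 3 :> nat | w1 == 4 :> nat].
  by apply: circ_center_neighbour e2 _; rewrite // adj_sym.
have c3 := circ_center_neighbour n5 e2 a23.
have c4 := circ_center_neighbour n5 e2 a24.
have [n12 n13 n14 n23 [n24 n34]] := uniq4_neq u.
have [{n13} n13 _] := n13; have [{n14} n14 _] := n14; have [{n34} n34 _] := n34.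
rewrite -!val_eqE /= in n13 n14 n34.
case/andP: a13 => _; rewrite /circ_rel => a13.
have [f [bf fadj fE]] := circ_reflection n5 rG.
have [mid|nmid] := boolP (
    ((w1 == 1 :> nat) && (w3 == 3 :> nat)) || ((w1 == 3 :> nat) && (w3 == 1 :> nat))).
  left; apply: circ_center_cycle => //.
  by move: c4 mid n14 n34; clear; move=> *; splitb; lia.
have [side|nside] := boolP (
    ((w1 == 1 :> nat) && (w3 == 0 :> nat)) || ((w1 == 0 :> nat) && (w3 == 1 :> nat))).
  right; apply: circ_center_twin => //.
  by move: c4 side n14 n34; clear; move=> *; splitb; lia.
have far : ((w1 == 3 :> nat) && (w3 == 4 :> nat)) || ((w1 == 4 :> nat) && (w3 == 3 :> nat)).
  move: c1 c3 n13 a13 nmid nside n7; clear => c1 c3 n13 a13 nmid nside n7.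
  by splitb; lia.
right; apply: iso_trans (iso_sym (dte_iso w1 w2 w3 w4 bf fadj)).
apply: circ_center_twin => //; first exact: dte_site_image.
- by rewrite fE e2.
- by rewrite !fE; case/orP: far => /andP[/eqP-> /eqP->].
- rewrite !fE; move: c4 far n14 n34; clear; move=> *.
  by splitb; splitif; lia.
Qed.

(** In the octahedron every triangle and pendant edge looks the same: exchanging
antipodal vertices moves [v1] and [v3] to [1] and [3]. *)
Lemma circ6_site (v1 v2 v3 v4 : circ 6) :
  regular4 (circ 6) -> dte_site v1 v2 v3 v4 -> iso (circ 7) (dte v1 v2 v3 v4).
Proof.
move=> rG st; have n5 : 5 <= 6 by [].
have [w1 [w2 [w3 [w4 [e2 {}st /iso_sym wv]]]]] := circ_site_center n5 rG st.
apply: iso_trans wv; move: {v1 v2 v3 v4} st.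
have reduce (x1 x2 x3 x4 : circ 6) (a : nat) : a < 2 -> dte_site x1 x2 x3 x4 -> x2 = 2 :> nat ->
    (forall v1 v3 v4 : circ 6,
       v1 = (if x1 == a :> nat then a + 3 else if x1 == a + 3 :> nat then a else x1) :> nat ->
       v3 = (if x3 == a :> nat then a + 3 else if x3 == a + 3 :> nat then a else x3) :> nat ->
       v4 = (if x4 == a :> nat then a + 3 else if x4 == a + 3 :> nat then a else x4) :> nat ->
       dte_site v1 x2 v3 v4 -> iso (circ 7) (dte v1 x2 v3 v4)) ->
    iso (circ 7) (dte x1 x2 x3 x4).
  move=> a2 st e2' H; have [f [bf fadj fE]] := circ6_swap (ltnW a2) rG.
  have f2 : f x2 = x2.
    by apply: val_inj; rewrite /= fE e2'; clear -a2; splitif; lia.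
  apply: iso_trans (iso_sym (dte_iso x1 x2 x3 x4 bf fadj)); rewrite f2.
  by apply: H; rewrite ?fE // -f2; apply: dte_site_image.
have final (x1 x3 x4 : circ 6) : dte_site x1 w2 x3 x4 ->
    ((x1 == 1 :> nat) && (x3 == 3 :> nat)) || ((x1 == 3 :> nat) && (x3 == 1 :> nat)) ->
    iso (circ 7) (dte x1 w2 x3 x4).
  move=> st h; apply: circ_center_cycle => //.
  case: (st) => u _ a24; have c4 := circ_center_neighbour n5 e2 a24.
  have [n12 n13 [n14 _] n23 [n24 [n34 _]]] := uniq4_neq u.
  rewrite -!val_eqE /= in n14 n34; move: c4 h n14 n34; clear; move=> *.
  by splitb; lia.
move=> st; case: (st) => u [a12 a23 a13] a24.
have c1 : [|| w1 == 0 :> nat, w1 == 1 :> nat, w1 == 3 :> nat | w1 == 4 :> nat].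
  by apply: circ_center_neighbour e2 _; rewrite // adj_sym.
have c3 := circ_center_neighbour n5 e2 a23.
have [n12 [n13 _] n14 n23 _] := uniq4_neq u; rewrite -val_eqE /= in n13.
case/andP: a13 => _; rewrite /circ_rel => a13.
move: st c1 c3 n13 a13; clear -reduce final e2; move=> st c1 c3 n13 a13.
(* A vertex 0 or 4 among [v1], [v3] is sent to its antipode 3 or 1. *)
have [has0|no0] := boolP ((w1 == 0 :> nat) || (w3 == 0 :> nat)).
  apply: (reduce _ _ _ _ 0) => // x1 x3 x4 E1 E3 _ stx.
  have [has4|no4] := boolP ((w1 == 4 :> nat) || (w3 == 4 :> nat)).
    apply: (reduce _ _ _ _ 1) => // y1 y3 y4 F1 F3 _ sty.
    apply: final => //; rewrite F1 F3 E1 E3.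
    by move: n13 a13 has0 has4; case/or4P: c1 => /eqP->; case/or4P: c3 => /eqP->.
  apply: final => //; rewrite E1 E3.
  by move: n13 a13 has0 no4; case/or4P: c1 => /eqP->; case/or4P: c3 => /eqP->.
have [has4|no4] := boolP ((w1 == 4 :> nat) || (w3 == 4 :> nat)).
  apply: (reduce _ _ _ _ 1) => // y1 y3 y4 F1 F3 _ sty.
  apply: final => //; rewrite F1 F3.
  by move: n13 a13 no0 has4; case/or4P: c1 => /eqP->; case/or4P: c3 => /eqP->.
apply: final => //.
by move: n13 a13 no0 no4; case/or4P: c1 => /eqP->; case/or4P: c3 => /eqP->.
Qed.

Lemma circ5_adj (x y : circ 5) : adj x y = (x != y).
Proof.
rewrite /= /nat_adj; case: eqVneq => //= xy; rewrite -val_eqE /= in xy.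
by case: x y xy => [[|[|[|[|[|]]]]] hx] // [[|[|[|[|[|]]]]] hy].
Qed.

Lemma circ5_iso : iso (circ 5) (complete_graph 5).
Proof. by exists id; [exists id | move=> x y; rewrite circ5_adj]. Qed.

(** Every permutation of [K5] is an automorphism. *)
Lemma circ5_site (v1 v2 v3 v4 : circ 5) :
  regular4 (circ 5) -> dte_site v1 v2 v3 v4 -> iso (circ 6) (dte v1 v2 v3 v4).
Proof.
move=> rG st; case: (st) => u _ _.
have [v0 _ v0N] : exists2 v0 : circ 5, v0 \in setT & v0 \notin [:: v1; v2; v3; v4].
  have : ~~ ([set: circ 5] \subset [:: v1; v2; v3; v4]).
    apply/negP => /subset_leq_card; rewrite cardsT card_ord => h.
    by have := leq_trans h (card_size _).
  by case/subsetPn => v0 h1 h2; exists v0.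
pose s := [:: v0; v1; v2; v3; v4].
have us : uniq s by rewrite /s cons_uniq v0N.
pose f (i : circ 5) : circ 5 := nth v0 s (i : 'I_5).
have fI : injective f.
  by move=> i j /eqP; rewrite /f nth_uniq ?ltn_ord // => /eqP /val_inj.
have bf : bijective f by apply: injF_bij.
have fadj x y : adj (f x) (f y) = adj x y by rewrite !circ5_adj (inj_eq fI).
pose w i (h : i < 5) : circ 5 := Ordinal h.
have fw i (h : i < 5) : f (w i h) = nth v0 s i by [].
have := dte_iso (w 1 isT) (w 2 isT) (w 3 isT) (w 4 isT) bf fadj.
by rewrite !fw /=; apply: iso_trans; apply: circ_expansion => //; split; rewrite ?circ5_adj.
Qed.

Lemma triangles_complete n : #|triangles (complete_graph n)| = 'C(n, 3).
Proof.
rewrite -[in RHS](card_ord n) -card_draws; apply: eq_card => A; rewrite !inE.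
case: eqP => // _ /=; apply/forall_inP => x _; apply/forall_inP => y _.
by rewrite /= implybb.
Qed.

Lemma card_nat_graph_set n r (A : {set nat_graph n r}) (P : pred nat) :
  (forall x : nat_graph n r, (x \in A) = P (x : 'I_n)) -> #|A| = \sum_(x < n) P x.
Proof.
by move=> AP; rewrite -sum1_card big_mkcond; apply: eq_bigr => x _; rewrite AP; case: (P x).
Qed.

Lemma circ_site_exists n : 5 <= n ->
  exists v1 v2 v3 v4 : circ n, [/\ v1 = 1 :> nat, v2 = 2 :> nat, v3 = 3 :> nat,
    v4 = 4 :> nat & dte_site v1 v2 v3 v4].
Proof.
move=> n5; have h i : i < 5 -> i < n by move=> i5; apply: leq_trans n5.
exists (Ordinal (h 1 isT)), (Ordinal (h 2 isT)), (Ordinal (h 3 isT)), (Ordinal (h 4 isT)).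
by split=> //; split=> //; split; rewrite /= /nat_adj -val_eqE /circ_rel.
Qed.

Lemma circ_descendant n : 5 <= n -> K5_descendant (circ n).
Proof.
elim: n => // n IH; rewrite leq_eqVlt => /orP[/eqP<-|n5].
  exact: K5_descendant_iso K5_descendant_base (iso_sym circ5_iso).
have dn := IH n5; have [v1 [v2 [v3 [v4 [e1 e2 e3 e4 st]]]]] := circ_site_exists n5.
apply: (K5_descendant_step dn st).
exact: circ_expansion (K5_descendant_regular4 dn) st e1 e2 e3 e4.
Qed.

Lemma circ_regular4 n : 5 <= n -> regular4 (circ n).
Proof. by move=> n5; apply/K5_descendant_regular4/circ_descendant. Qed.

(** For [n = 5] the vertices [1], [3] have the common neighbours [0], [4] besides
[2], and [0] is a further common neighbour of [2], [4].  For [n = 6] there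
remain [5] and [0], and for larger [n] none. *)
Lemma circ_levelS n : 5 <= n ->
  level (circ n.+1) = (level (circ n) + (if n == 5 then 3 else if n == 6 then 2 else 0)%N%:Z)%R.
Proof.
move=> n5; have [v1 [v2 [v3 [v4 [e1 e2 e3 e4 st]]]]] := circ_site_exists n5.
have -> := iso_level (circ_expansion n5 (circ_regular4 n5) st e1 e2 e3 e4).
rewrite (dte_level st); congr (_ + Posz _)%R.
pose P13 (x : nat) := [&& x != 2, x != 1, x != 3,
  circ_rel n x 1 || circ_rel n 1 x & circ_rel n x 3 || circ_rel n 3 x].
pose P24 (x : nat) := [&& x != 2, x != 4, x != 1, x != 3,
  circ_rel n x 2 || circ_rel n 2 x & circ_rel n x 4 || circ_rel n 4 x].
have memE (x : circ n) : ((x \in common_neighbours v1 v3 :\ v2) = P13 x) *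
    ((x \in common_neighbours v2 v4 :\: [set v1; v3]) = P24 x).
  rewrite /P13 /P24.
  rewrite !inE -!val_eqE /= /nat_adj -!val_eqE /= e1 e2 e3 e4.
  by split; case: (_ == 1); case: (_ == 2); case: (_ == 3); case: (_ == 4); rewrite ?andbF.
rewrite (@card_nat_graph_set _ _ _ P13 (fun x => (memE x).1)).
rewrite (@card_nat_graph_set _ _ _ P24 (fun x => (memE x).2)).
rewrite {memE}/P13 {}/P24.
case: eqP => [n5E|n5N].
  by rewrite n5E !big_ord_recl !big_ord0.
case: eqP => [n6E|n6N].
  by rewrite n6E !big_ord_recl !big_ord0.
rewrite !big1 // => x _; apply/eqP; rewrite eqb0; apply/negP; rewrite /circ_rel => h.
  by have := ltn_ord x; splitb; lia.
by have := ltn_ord x; splitb; lia.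
Qed.

Lemma circ_level n : 7 <= n -> level (circ n) = 0%R.
Proof.
elim: n => // n IH; rewrite leq_eqVlt => /orP[/eqP<-|n7].
  rewrite circ_levelS // circ_levelS // (iso_level circ5_iso) /level /graph_order card_ord.
  by rewrite triangles_complete.
by rewrite circ_levelS ?IH //; [case: n n7 {IH} => [|[|[|[|[|[|[|]]]]]]] | lia].
Qed.

Lemma circ_level_le0 n : 5 <= n -> (level (circ n) <= 0)%R.
Proof.
move=> n5; have [n7|] := leqP 7 n; first by rewrite circ_level.
case: n n5 => [|[|[|[|[|[|[|]]]]]]] // _ _.
  by rewrite (iso_level circ5_iso) /level /graph_order card_ord triangles_complete.
rewrite circ_levelS //.
by rewrite (iso_level circ5_iso) /level /graph_order card_ord triangles_complete.
Qed.

(** * Expansions of twins *)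

Lemma dte_level_ltl (G : sgraph) (v1 v2 v3 v4 x : G) : dte_site v1 v2 v3 v4 ->
  x != v2 -> adj x v1 -> adj x v3 -> (level G < level (dte v1 v2 v3 v4))%R.
Proof.
move=> st xv x1 x3; rewrite (dte_level st).
have : 0 < #|common_neighbours v1 v3 :\ v2|.
  by apply/card_gt0P; exists x; rewrite !inE xv x1.
lia.
Qed.

Lemma dte_level_ltr (G : sgraph) (v1 v2 v3 v4 x : G) : dte_site v1 v2 v3 v4 ->
  x != v1 -> x != v3 -> adj x v2 -> adj x v4 -> (level G < level (dte v1 v2 v3 v4))%R.
Proof.
move=> st xv xw x2 x4; rewrite (dte_level st).
have : 0 < #|common_neighbours v2 v4 :\: [set v1; v3]|.
  by apply/card_gt0P; exists x; rewrite !inE negb_or xv xw x2.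
lia.
Qed.

Section Twin.

Variables n k : nat.
Hypotheses (k3 : 3 <= k) (kn : k + 5 <= n).

(** Starting the numbering at the other common end exchanges the two zigzags. *)
Lemma twin_swap (k' : nat) : k + k' + 2 = n -> regular4 (twin n k') ->
  exists f : twin n k -> twin n k', [/\ bijective f, forall x y, adj (f x) (f y) = adj x y
    & forall i : 'I_n, f i = (if k < i then i - k.+1 else i + k'.+1) :> nat].
Proof.
move=> kk rG.
apply: (relabel_iso (s := fun i => if k < i then i - k.+1 else i + k'.+1)) => //.
- exact: twin_min_degree4.
- move=> i; splitif; lia.
- move=> i j; splitif; lia.
- move=> i j hi hj h; rewrite /twin_rel in h *; casework.
Qed.

(** The new vertex is inserted after [v2].  At the end of the zigzag, where
[v2] is [k], the neighbour of [v2] on that side is [n.-1]. *)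
Lemma twin_expansion_right (v1 v2 v3 v4 : twin n k) (i : nat) :
  regular4 (twin n k) -> dte_site v1 v2 v3 v4 -> i < k ->
  v1 = i :> nat -> v2 = i.+1 :> nat -> v3 = i.+2 :> nat ->
  v4 = (if i.+1 < k then i.+3 else n.-1) :> nat ->
  iso (twin n.+1 k.+1) (dte v1 v2 v3 v4).
Proof.
move=> rG st ik e1 e2 e3 e4.
apply: (@expansion_iso n i.+2 _ _ (fun j => if j < i.+2 then j else j.-1)).
- by apply: twin_min_degree4; lia.
- exact: dte_regular4.
- move=> j; splitif; lia.
- move=> a b; splitif; lia.
- move=> a b ha hb ap bp h; rewrite e1 e2 e3 e4; rewrite /twin_rel in h *.
  casework.
- move=> j hj jp h; rewrite e1 e2 e3 e4; rewrite /twin_rel in h *.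
  casework.
Qed.

(** The new vertex is inserted before [v2].  At the start of the zigzag, where
[v2] is [1], the neighbour of [v2] on that side is [k.+2]. *)
Lemma twin_expansion_left (v1 v2 v3 v4 : twin n k) (i : nat) :
  regular4 (twin n k) -> dte_site v1 v2 v3 v4 -> i < k ->
  v1 = i :> nat -> v2 = i.+1 :> nat -> v3 = i.+2 :> nat ->
  v4 = (if i == 0 then k.+2 else i.-1) :> nat ->
  iso (twin n.+1 k.+1) (dte v1 v2 v3 v4).
Proof.
move=> rG st ik e1 e2 e3 e4.
apply: (@expansion_iso n i.+1 _ _ (fun j => if j < i.+1 then j else j.-1)).
- by apply: twin_min_degree4; lia.
- exact: dte_regular4.
- move=> j; splitif; lia.
- move=> a b; splitif; lia.
- move=> a b ha hb ap bp h; rewrite e1 e2 e3; rewrite /twin_rel in h *.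
  move: e4; clear st e1 e2 e3; case: (posnP i) => [i0|i0]; [subst i|];
    move=> ->; casework.
- move=> j hj jp h; rewrite e1 e2 e3; rewrite /twin_rel in h *.
  move: e4; clear st e1 e2 e3; case: (posnP i) => [i0|i0]; [subst i|];
    move=> ->; casework.
Qed.

Definition zone1 (x : nat) : bool := x <= k.+1.
Definition zone2 (x : nat) : bool := (x == 0) || (k < x).

Lemma twin_rel_lt i j : j < n -> twin_rel n k i j -> i < j.
Proof. by rewrite /twin_rel => jn h; splitb; lia. Qed.

Lemma twin_rel_triangle x y z : z < n ->
  twin_rel n k x y -> twin_rel n k y z -> twin_rel n k x z ->
  zone1 z || (zone2 x && (k < y)).
Proof.
rewrite /zone1 /zone2 /twin_rel => zn xy yz xz.
have [h|h] := leqP z k.+1; first by [].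
by rewrite /=; splitb; try (exfalso; lia); solveb.
Qed.

(** The two crosswise edges lie in no triangle, since both zigzags have at least
three triangles. *)
Lemma twin_triangle (x y z : twin n k) : adj x y -> adj y z -> adj x z ->
  [&& zone1 x, zone1 y & zone1 z] || [&& zone2 x, zone2 y & zone2 z].
Proof.
have H (a b c : nat) : c < n -> twin_rel n k a b -> twin_rel n k b c -> twin_rel n k a c ->
    [&& zone1 a, zone1 b & zone1 c] || [&& zone2 a, zone2 b & zone2 c].
  move=> cn ab bc ac; have b_c := twin_rel_lt cn bc.
  have a_b := twin_rel_lt (ltn_trans b_c cn) ab.
  by have := twin_rel_triangle cn ab bc ac; rewrite /zone1 /zone2 => h; splitb; solveb.
case/andP => _ xy /andP[_ yz] /andP[_ xz].
have {}H (a b c : twin n k) := H a b c (ltn_ord c).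
case/orP: xy => xy; case/orP: yz => yz; case/orP: xz => xz.
- exact: H.
- have := twin_rel_lt (ltn_ord y) xy; have := twin_rel_lt (ltn_ord z) yz.
  have := twin_rel_lt (ltn_ord x) xz; lia.
- by have := H _ _ _ xz yz xy; rewrite ![zone1 z && _]andbC ![zone2 z && _]andbC.
- by have := H _ _ _ xz xy yz; do 3 case: (zone1 _) => //; do 3 case: (zone2 _).
- by have := H _ _ _ xy xz yz; do 3 case: (zone1 _) => //; do 3 case: (zone2 _).
- by have := H _ _ _ yz xz xy; do 3 case: (zone1 _) => //; do 3 case: (zone2 _).
- have := twin_rel_lt (ltn_ord x) xy; have := twin_rel_lt (ltn_ord y) yz.
  have := twin_rel_lt (ltn_ord z) xz; lia.
- by have := H _ _ _ yz xy xz; do 3 case: (zone1 _) => //; do 3 case: (zone2 _).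
Qed.

Lemma twin_zone1_adj (x y : twin n k) : zone1 x -> zone1 y -> adj x y ->
  [|| x == y.+1 :> nat, x == y.+2 :> nat, y == x.+1 :> nat | y == x.+2 :> nat].
Proof.
rewrite /zone1 => zx zy /andP[_]; rewrite /twin_rel.
by have := ltn_ord x; have := ltn_ord y; move=> xn yn h; splitb; try (exfalso; lia); solveb.
Qed.

Lemma twin_adj (x y : nat) (hx : x < n) (hy : y < n) :
  x != y -> twin_rel n k x y || twin_rel n k y x ->
  @adj (twin n k) (Ordinal hx) (Ordinal hy).
Proof. by move=> xy h; rewrite /= /nat_adj -val_eqE /= xy. Qed.

End Twin.

(** If [v2] is the middle of the triangle [v2 - 1], [v2], [v2 + 1], the expansion
lengthens the zigzag.  If [v2] is an outer vertex of the triangle, the edge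
between [v1] and [v3] lies in the next triangle of the zigzag, or else the
triangle is the last one, and then [v4] and the fourth neighbour of [v2] are
adjacent; in both cases the level rises. *)
Lemma twin_site_zone1 n k (v1 v2 v3 v4 : twin n k) :
  3 <= k -> k + 5 <= n -> regular4 (twin n k) -> dte_site v1 v2 v3 v4 ->
  zone1 k v1 -> zone1 k v2 -> zone1 k v3 ->
  (level (twin n k) < level (dte v1 v2 v3 v4))%R \/
  iso (twin n.+1 k.+1) (dte v1 v2 v3 v4).
Proof.
move=> k3 kn rG; wlog v13 : v1 v3 / v1 < v3.
  move=> H st z1 z2 z3; have [v13|v13] := ltnP v1 v3; first exact: H.
  have v31 : v3 < v1.
    rewrite ltn_neqAle v13 andbT; case: st => u _ _.
    by have [_ [_ e] _ _ _] := uniq4_neq u; rewrite -val_eqE /= in e; rewrite e.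
  have := H v3 v1 v31 (dte_site_swap st) z3 z2 z1.
  rewrite (iso_level (dte_swap v3 v2 v1 v4)) => -[|h]; first by left.
  by right; apply: iso_trans h (dte_swap _ _ _ _).
move=> st z1 z2 z3; case: (st) => u [a12 a23 a13] a24.
have := twin_zone1_adj k3 kn z1 z2 a12.
have := twin_zone1_adj k3 kn z2 z3 a23.
have := twin_zone1_adj k3 kn z1 z3 a13.
have := uniq4_neq u => -[_ _ [_ n14] _ [[_ n24] [_ n34]]].
rewrite -!val_eqE /= in n14 n24 n34.
case/andP: a24 => _; have := ltn_ord v4; rewrite /zone1 in z1 z2 z3.
have n1 := ltn_ord v1; have n2 := ltn_ord v2; have n3 := ltn_ord v3.
move=> n4 a24 c13 c23 c12.
(* [v2] is the smallest vertex of the triangle. *)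
have [b1|b1] := ltnP v2 v1.
  have [e1 e3] : v1 = v2.+1 :> nat /\ v3 = v2.+2 :> nat.
    by clear -b1 v13 c12 c23; split; splitb; lia.
  left; have [h|h] := leqP v2.+3 k.+1.
    have hx : v2.+3 < n by lia.
    apply: (@dte_level_ltl (twin n k) _ _ _ _ (Ordinal hx) st);
      rewrite /= /nat_adj -?val_eqE /= ?e1 ?e3 /twin_rel.
    - lia.
    - clear -h; apply/andP; split; [lia|solveb].
    - clear -h; apply/andP; split; [lia|solveb].
  have e2 : v2 = k.-1 :> nat by lia.
  have [x [hx xN]] : exists x, x < n /\ [/\ x != v1, x != v3, x != v2, x != v4 &
      (twin_rel n k x v2 || twin_rel n k v2 x) && (twin_rel n k x v4 || twin_rel n k v4 x)].
    have : (v4 == k.-2 :> nat) || (v4 == k.-2.-1 :> nat).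
      rewrite e2 e1 e3 /twin_rel in a24 n14 n34; clear -a24 n14 n34 k3 kn e2.
      by splitb; lia.
    case/orP => /eqP e4; [exists k.-2.-1|exists k.-2];
      rewrite e4 e1 e3 e2 /twin_rel; clear -k3 kn; split; try lia; split; solveb.
  case: xN => x1 x3 x2 x4 /andP[r2 r4].
  by apply: (@dte_level_ltr (twin n k) _ _ _ _ (Ordinal hx) st);
    rewrite /= /nat_adj -?val_eqE /= ?x1 ?x2 ?x3 ?x4.
(* [v2] is the largest vertex of the triangle. *)
have [b3|b3] := ltnP v3 v2.
  have [e1 e3] : v1 = v2.-2 :> nat /\ v3 = v2.-1 :> nat.
    by clear -b3 v13 c12 c23; split; splitb; lia.
  have v2_2 : 2 <= v2 by lia.
  left; have [h|h] := leqP 3 v2.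
    have hx : v2.-2.-1 < n by lia.
    apply: (@dte_level_ltl (twin n k) _ _ _ _ (Ordinal hx) st);
      rewrite /= /nat_adj -?val_eqE /= ?e1 ?e3 /twin_rel.
    - lia.
    - clear -h z2; apply/andP; split; [lia|solveb].
    - clear -h z2; apply/andP; split; [lia|solveb].
  have e2 : v2 = 2 :> nat by lia.
  have [x [hx xN]] : exists x, x < n /\ [/\ x != v1, x != v3, x != v2, x != v4 &
      (twin_rel n k x v2 || twin_rel n k v2 x) && (twin_rel n k x v4 || twin_rel n k v4 x)].
    have : (v4 == 3 :> nat) || (v4 == 4 :> nat).
      rewrite e1 e3 e2 /= /twin_rel in a24 n14 n34; clear -a24 n14 n34 k3 kn e2.
      by splitb; lia.
    case/orP => /eqP e4; [exists 4|exists 3];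
      rewrite e4 e1 e3 e2 /twin_rel; clear -k3 kn; split; try lia; split; solveb.
  case: xN => x1 x3 x2 x4 /andP[r2 r4].
  by apply: (@dte_level_ltr (twin n k) _ _ _ _ (Ordinal hx) st);
    rewrite /= /nat_adj -?val_eqE /= ?x1 ?x2 ?x3 ?x4.
have [e2 e3] : v2 = v1.+1 :> nat /\ v3 = v1.+2 :> nat.
  by clear -b1 b3 v13 c12 c23 c13; split; splitb; lia.
have ik : v1 < k by lia.
right.
have [r|l] : v4 = (if v1.+1 < k then v1.+3 else n.-1) :> nat \/
       v4 = (if v1 == 0 :> nat then k.+2 else v1.-1) :> nat.
  rewrite e3 e2 /twin_rel in a24 n14 n34; clear -a24 n14 n34 k3 kn ik n4.
  splitb; splitif; lia.
- exact: (twin_expansion_right k3 kn rG st ik).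
- exact: (twin_expansion_left k3 kn rG st ik).
Qed.

(** Triangles of the second zigzag are moved to the first by [twin_swap]. *)
Lemma twin_site_cases n k (v1 v2 v3 v4 : twin n k) :
  3 <= k -> k + 5 <= n -> (forall j, 3 <= j -> j + 5 <= n -> regular4 (twin n j)) ->
  dte_site v1 v2 v3 v4 ->
  (level (twin n k) < level (dte v1 v2 v3 v4))%R \/
  exists2 j, 3 <= j /\ j + 5 <= n.+1 & iso (twin n.+1 j) (dte v1 v2 v3 v4).
Proof.
move=> k3 kn rT st; case: (st) => _ [a12 a23 a13] _.
case/orP: (twin_triangle k3 kn a12 a23 a13) => /and3P[z1 z2 z3].
  have [|h] := twin_site_zone1 k3 kn (rT _ k3 kn) st z1 z2 z3; first by left.
  by right; exists k.+1 => //; lia.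
have [j kj] : exists j, k + j + 2 = n by exists (n - k - 2); lia.
have [j3 jn] : 3 <= j /\ j + 5 <= n by lia.
have [f [bf fadj fE]] := twin_swap k3 kn kj (rT _ j3 jn).
have fz (x : twin n k) : zone2 k x -> zone1 j (f x).
  by rewrite /zone1 /zone2 fE; have := ltn_ord x; clear -kj; move=> *; splitif; lia.
have is_f := dte_iso v1 v2 v3 v4 bf fadj.
have := twin_site_zone1 j3 jn (rT _ j3 jn) (dte_site_image bf fadj st)
  (fz _ z1) (fz _ z2) (fz _ z3).
rewrite -(iso_level is_f) -(iso_level (ex_intro2 _ _ f bf fadj)) => -[|h]; first by left.
by right; exists j.+1; [lia | apply: iso_trans (iso_sym is_f)].
Qed.

Lemma circ7_twin_site : exists v1 v2 v3 v4 : circ 7, [/\ v1 = 1 :> nat, v2 = 2 :> nat,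
  v3 = 0 :> nat, v4 = 3 :> nat & dte_site v1 v2 v3 v4].
Proof.
pose v i (h : i < 7) : circ 7 := Ordinal h.
by exists (v 1 isT), (v 2 isT), (v 0 isT), (v 3 isT); split.
Qed.

Lemma twin_site_exists n k : 3 <= k -> k + 5 <= n ->
  exists v1 v2 v3 v4 : twin n k, [/\ v1 = 0 :> nat, v2 = 1 :> nat, v3 = 2 :> nat,
    v4 = 3 :> nat & dte_site v1 v2 v3 v4].
Proof.
move=> k3 kn; have h i : i < 4 -> i < n by lia.
exists (Ordinal (h 0 isT)), (Ordinal (h 1 isT)), (Ordinal (h 2 isT)), (Ordinal (h 3 isT)).
by split=> //; split=> //; [split|]; apply: twin_adj => //; rewrite /twin_rel; solveb.
Qed.

Lemma twin_site_level n k (v1 v2 v3 v4 : twin n k) : 3 <= k -> k + 5 <= n ->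
  v1 = 0 :> nat -> v2 = 1 :> nat -> v3 = 2 :> nat -> v4 = 3 :> nat ->
  dte_site v1 v2 v3 v4 -> level (dte v1 v2 v3 v4) = level (twin n k).
Proof.
move=> k3 kn e1 e2 e3 e4 st; rewrite (dte_level st).
have [s1 s2] : common_neighbours v1 v3 :\ v2 = set0 /\
    common_neighbours v2 v4 :\: [set v1; v3] = set0.
  split; apply/setP => x; rewrite !inE -!val_eqE /= /nat_adj -!val_eqE /= e1 e2 e3 ?e4;
    apply/negP => h; rewrite /twin_rel in h; have := ltn_ord x; clear -k3 kn h; move=> xn;
    by splitb; lia.
by rewrite s1 s2 !cards0 GRing.addr0.
Qed.

(** From [twin 8 3], an expansion of [circ 7], all twins arise by lengthening
zigzags.  Lengthening the first one gives [k > 3]; for [k = 3] the two zigzags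
are exchanged first. *)
Lemma twin_descendant n k : 3 <= k -> k + 5 <= n ->
  K5_descendant (twin n k) /\ level (twin n k) = 2%Z.
Proof.
elim: n k => [|n IH] k k3 kn; first by lia.
have grow j : 3 <= j -> j + 5 <= n ->
    K5_descendant (twin n.+1 j.+1) /\ level (twin n.+1 j.+1) = 2%Z.
  move=> j3 jn; have [dj lj] := IH j j3 jn.
  have [v1 [v2 [v3 [v4 [e1 e2 e3 e4 st]]]]] := twin_site_exists j3 jn.
  have j1 : v1 < j by rewrite e1; lia.
  have I : iso (twin n.+1 j.+1) (dte v1 v2 v3 v4).
    apply: (twin_expansion_right j3 jn (K5_descendant_regular4 dj) st j1) => //; rewrite e1 //.
    by rewrite e4 ifT //; lia.
  split; first exact: K5_descendant_step dj st I.
  by rewrite (iso_level I) (twin_site_level j3 jn e1 e2 e3 e4 st).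
have [n7|n8] : n = 7 \/ 8 <= n by lia.
  rewrite {}n7 in kn *; have -> : k = 3 by lia.
  have [v1 [v2 [v3 [v4 [e1 e2 e3 e4 st]]]]] := circ7_twin_site.
  have I := circ_twin_expansion3 (leqnn 7) (circ_regular4 (n := 7) isT) st e1 e2 e3 e4.
  split; first exact: K5_descendant_step (circ_descendant (n := 7) isT) st I.
  rewrite (iso_level I) (dte_level st) circ_level //; congr (Posz _).
  pose P (x : nat) := [&& x != 2, x != 1, x != 0,
    circ_rel 7 x 1 || circ_rel 7 1 x & circ_rel 7 x 0 || circ_rel 7 0 x].
  pose Q (x : nat) := [&& x != 2, x != 3, x != 1, x != 0,
    circ_rel 7 x 2 || circ_rel 7 2 x & circ_rel 7 x 3 || circ_rel 7 3 x].
  rewrite (@card_nat_graph_set _ _ _ P) ?(@card_nat_graph_set _ _ _ Q) => [|x|x].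
  - by rewrite !big_ord_recl !big_ord0.
  - rewrite !inE -!val_eqE /= /nat_adj -!val_eqE /= e1 e2 e3 e4 /Q.
    by case: (_ == 0); case: (_ == 1); case: (_ == 2); case: (_ == 3); rewrite ?andbF.
  - rewrite !inE -!val_eqE /= /nat_adj -!val_eqE /= e1 e2 e3 /P.
    by case: (_ == 0); case: (_ == 1); case: (_ == 2); rewrite ?andbF.
have [k4|k3'] := ltnP 3 k.
  by case: k k3 kn k4 => // k k3 kn k4; apply: grow; lia.
have kE : k = 3 by lia.
have [dj lj] : K5_descendant (twin n.+1 (n - 5).+1) /\ level (twin n.+1 (n - 5).+1) = 2%Z.
  by apply: grow; lia.
have kj : k + (n - 5).+1 + 2 = n.+1 by lia.
have [f [bf fadj _]] := twin_swap k3 kn kj (K5_descendant_regular4 dj).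
have I : iso (twin n.+1 k) (twin n.+1 (n - 5).+1) by exists f.
by split; [apply: K5_descendant_iso dj (iso_sym I) | rewrite (iso_level I)].
Qed.

(** * Descendants of level 2 *)

Lemma dte_level_le (G : sgraph) (v1 v2 v3 v4 : G) :
  dte_site v1 v2 v3 v4 -> (level G <= level (dte v1 v2 v3 v4))%R.
Proof. by move=> st; rewrite (dte_level st); lia. Qed.

Lemma twin_regular4 n k : 3 <= k -> k + 5 <= n -> regular4 (twin n k).
Proof. by move=> k3 kn; apply: K5_descendant_regular4; case: (twin_descendant k3 kn). Qed.

Definition iso_twin (G : sgraph) : Prop :=
  exists n k, [/\ 3 <= k, k + 5 <= n & iso (twin n k) G].

Lemma iso_twin_iso (G H : sgraph) : iso_twin G -> iso G H -> iso_twin H.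
Proof. by move=> [n [k [k3 kn I]]] GH; exists n, k; split=> //; apply: iso_trans GH. Qed.

(** By monotonicity a graph of level above 2 has no descendants of level 2, so
that nothing else needs to be known about it. *)
Lemma K5_descendant_cases (G : sgraph) : K5_descendant G ->
  [\/ exists2 n, 5 <= n & iso (circ n) G, iso_twin G | (2%Z < level G)%R].
Proof.
elim=> {G} [|G v1 v2 v3 v4 dG IH _ st|G H _ IH GH].
- by constructor 1; exists 5; last exact: circ5_iso.
- case: IH => [[n n5 [f bf fadj]]|[n [k [k3 kn [f bf fadj]]]]|h]; last first.
  + by constructor 3; have := dte_level_le st; lia.
  + case: (bf) => g fK gK.
    have bg : bijective g by exists f.
    have gadj x y : adj (g x) (g y) = adj x y by rewrite -fadj !gK.
    have I := dte_iso v1 v2 v3 v4 bg gadj.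
    have [lt|[j [j3 jn] J]] := twin_site_cases k3 kn (@twin_regular4 n) (dte_site_image bg gadj st).
      by constructor 3; rewrite (iso_level I); move: lt; case: (twin_descendant k3 kn) => _ ->.
    by constructor 2; exists n.+1, j; split=> //; apply: iso_trans (iso_sym I).
  + case: (bf) => g fK gK.
    have bg : bijective g by exists f.
    have gadj x y : adj (g x) (g y) = adj x y by rewrite -fadj !gK.
    have I := iso_sym (dte_iso v1 v2 v3 v4 bg gadj).
    have st' := dte_site_image bg gadj st; have rG := circ_regular4 n5.
    have [n7|n7] := leqP 7 n.
      have [J|J] := circ_site_cases n7 rG st'.
        by constructor 1; exists n.+1; [lia|apply: iso_trans I].
      by constructor 2; exists n.+1, 3; split; [lia|lia|apply: iso_trans I].
    constructor 1; exists n.+1; first by lia.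
    apply: iso_trans I.
    have [nE|nE] : n = 5 \/ n = 6 by lia.
      by clear -nE rG st'; subst n; apply: circ5_site.
    by clear -nE rG st'; subst n; apply: circ6_site.
- case: IH => [[n n5 I]|I|h].
  + by constructor 1; exists n => //; apply: iso_trans GH.
  + by constructor 2; apply: iso_twin_iso GH.
  + by constructor 3; rewrite -(iso_level GH).
Qed.

Lemma level2_descendantP (G : sgraph) :
  (K5_descendant G /\ level G = 2%Z) <-> iso_twin G.
Proof.
split=> [[dG lG]|[n [k [k3 kn I]]]]; last first.
  have [d l] := twin_descendant k3 kn.
  by split; [apply: K5_descendant_iso I|rewrite -(iso_level I)].
case: (K5_descendant_cases dG) => [[n n5 I]|//|]; last by rewrite lG.
by have := circ_level_le0 n5; rewrite (iso_level I) lG.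
Qed.

Lemma K5_descendant_completed_primitive (G : sgraph) :
  K5_descendant G -> completed_primitive G.
Proof.
move=> dG; split; first exact: K5_descendant_regular4.
have [c0 cG] : 0 < #|G| /\ cuts_ge6 G.
  elim: dG => {G} [|G v1 v2 v3 v4 dG [c0 cG] rG st|G H _ [c0 cG] GH].
  - by rewrite card_ord; split=> //; exact: cuts_ge6_K5.
  - by rewrite card_option; split=> //; apply: dte_cuts_ge6.
  - by split; [rewrite -[#|H|](iso_order GH)|apply: cuts_ge6_iso cG].
by apply: internally_6_of_cuts => //; apply: K5_descendant_regular4.
Qed.

(** * Zigzags in twins *)

Lemma image_edgeP (H G : sgraph) (f : H -> G) (e : {set G}) :
  reflect (exists x y, adj x y /\ e = [set f x; f y]) (e \in (image_subgraph f).2).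
Proof.
apply: (iffP imsetP) => [[d /imsetP[[x y] + ->] ->]|[x [y [xy ->]]]].
  by rewrite inE /= => xy; exists x, y; rewrite imsetU !imset_set1.
exists [set x; y]; last by rewrite imsetU !imset_set1.
by apply/imsetP; exists (x, y); rewrite ?inE.
Qed.

(** The casts expose the underlying ordinals, on which coercion to [nat] and
rewriting with [inordK] work. *)
Lemma zigzag_adjE m (i j : zigzag m) : adj i j =
  [|| (j : 'I__) == i.+1 :> nat, (j : 'I__) == i.+2 :> nat,
      (i : 'I__) == j.+1 :> nat | (i : 'I__) == j.+2 :> nat].
Proof. by []. Qed.

Section ZigzagsOfTwins.

Variables n k : nat.
Hypotheses (k3 : 3 <= k) (kn : k + 5 <= n).

(** Consecutive triangles of a zigzag share an edge, whereas the two zones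
share only the two end vertices, which are not adjacent. *)
Lemma zigzag_in_zone m (g : zigzag m -> twin n k) : 0 < m -> homomorphism g ->
  (forall i, zone1 k (g i)) \/ (forall i, zone2 k (g i)).
Proof.
move=> m0 gh; pose P (i : nat) : twin n k := g (inord i).
have Pg (i : zigzag m) : g i = P (i : 'I__) by rewrite /P inord_val.
have Padj i j : i < j -> j <= i.+2 -> j < m.+2 -> adj (P i) (P j).
  move=> ij ji jm; apply: gh; rewrite zigzag_adjE !inordK; lia.
have tri i : i < m -> [&& zone1 k (P i), zone1 k (P i.+1) & zone1 k (P i.+2)] ||
    [&& zone2 k (P i), zone2 k (P i.+1) & zone2 k (P i.+2)].
  by move=> im; apply: twin_triangle => //; apply: Padj; lia.
have disj (x y : twin n k) : adj x y -> zone1 k x -> zone2 k x -> zone1 k y -> zone2 k y -> False.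
  move=> /andP[_]; rewrite /zone1 /zone2 /twin_rel; have := ltn_ord x; have := ltn_ord y.
  by move=> *; splitb; lia.
have H t : t < m -> (forall i, i < t.+3 -> zone1 k (P i)) \/ (forall i, i < t.+3 -> zone2 k (P i)).
  elim: t => [|t IH] tm.
    by case/orP: (tri 0 tm) => /and3P[a b c]; [left|right]; case=> [|[|[|]]].
  have at1 : adj (P t.+1) (P t.+2) by apply: Padj; lia.
  case: (IH (ltnW tm)) => h; case/orP: (tri _ tm) => /and3P[a b c].
  - by left=> i; rewrite ltnS leq_eqVlt => /orP[/eqP->|/h].
  - by case: (disj _ _ at1 (h t.+1 _) a (h t.+2 _) b).
  - by case: (disj _ _ at1 a (h t.+1 _) b (h t.+2 _)).
  - by right=> i; rewrite ltnS leq_eqVlt => /orP[/eqP->|/h].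
have m1 : m.-1 < m by lia.
by case: (H m.-1 m1) => h; [left|right] => i; rewrite Pg; apply: h; have := ltn_ord i; lia.
Qed.

(** The zones have [k + 2] and [n - k] vertices. *)
Lemma zigzag_size_in_twin m (g : zigzag m -> twin n k) : 0 < m -> injective g ->
  homomorphism g -> m <= k \/ m <= n - k - 2.
Proof.
move=> m0 gI gh; case: (zigzag_in_zone m0 gh) => h; [left|right].
  have b i : g i < k.+2 by have := h i; rewrite /zone1; lia.
  have fI : injective (fun i => Ordinal (b i)).
    by move=> i j /(congr1 val) /= /val_inj /gI.
  by have := leq_card _ fI; rewrite !card_ord.
have b i : (if g i == 0 :> nat then 0 else g i - k) < (n - k.+2).+2.
  by have := h i; have := ltn_ord (g i); rewrite /zone2; case: eqP => //; lia.
have fI : injective (fun i => Ordinal (b i)).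
  move=> i j /(congr1 val) /= E; apply/gI/val_inj; move: E (h i) (h j); rewrite /zone2.
  by case: eqP => ?; case: eqP => ? /=; lia.
by have := leq_card _ fI; rewrite !card_ord; lia.
Qed.

(** A zigzag [c] spanning the zone [Z] is maximal: a larger one stays in [Z] or
in the other zone [Z'], and the latter misses a vertex of [c]. *)
Lemma maximal_zigzag_of_zone (G : sgraph) (phi : twin n k -> G) (Z Z' : pred nat)
    q (c : zigzag q -> twin n k) :
  bijective phi -> (forall x y, adj (phi x) (phi y) = adj x y) ->
  0 < q -> injective c -> (forall i j, adj (c i) (c j) = adj i j) ->
  (forall x : twin n k, Z x -> exists i, x = c i) -> (exists i, ~~ Z' (c i)) ->
  (forall m (g : zigzag m -> twin n k), 0 < m -> homomorphism g ->
     (forall i, Z (g i)) \/ (forall i, Z' (g i))) ->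
  maximal_zigzag_subgraph (image_subgraph (fun i => phi (c i))).
Proof.
move=> bphi phiadj q0 cI cadj Zc [i0 i0Z'] zones; case: (bphi) => psi phiK psiK.
split.
  exists q => //; exists (fun i => phi (c i)); split=> //.
  - by move=> i j /(bij_inj bphi) /cI.
  - by move=> i j ij; rewrite phiadj cadj.
move=> T [m m0 [g [gI gh ->]]] [sv se].
pose g' i := psi (g i); have gE i : g i = phi (g' i) by rewrite /g' psiK.
have gh' : homomorphism g' by move=> i j /gh; rewrite !gE phiadj.
have Zg i : Z (g' i).
  case: (zones m g' m0 gh') => [hZ|hZ']; [exact: hZ | exfalso].
  have /(subsetP sv)/imsetP[j _] : phi (c i0) \in (image_subgraph (fun i => phi (c i))).1.
    exact: imset_f.
  rewrite gE => /(bij_inj bphi) E; move: i0Z'.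
  by rewrite E hZ'.
have sv' : (image_subgraph g).1 \subset (image_subgraph (fun i => phi (c i))).1.
  apply/subsetP => _ /imsetP[i _ ->]; have [j jE] := Zc _ (Zg i).
  by apply/imsetP; exists j; rewrite // gE jE.
have se' : (image_subgraph g).2 \subset (image_subgraph (fun i => phi (c i))).2.
  apply/subsetP => _ /image_edgeP[x [y [xy ->]]]; apply/image_edgeP.
  have [i iE] := Zc _ (Zg x); have [j jE] := Zc _ (Zg y).
  exists i, j; rewrite !gE -iE -jE -cadj -iE -jE; split=> //; exact: gh'.
case: (image_subgraph g) sv se sv' se' => V E /= sv se sv' se'.
by congr (_, _); apply/eqP; rewrite eqEsubset ?sv ?sv' ?se ?se'.
Qed.

End ZigzagsOfTwins.

Lemma chain_sndE k1 k2 (j : zigzag k2) :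
  chain_snd k1 j = (if (j : 'I__) == k2.+1 :> nat then 0 else k1.+1 + j) :> nat.
Proof.
rewrite /chain_snd /=; have := ltn_ord j; case: eqP => [->|h] jk.
  by rewrite (_ : _ + _ = (k1 + k2).+2) ?modnn //; lia.
by rewrite modn_small //; lia.
Qed.

Lemma chain_snd_adj k1 k2 (i j : zigzag k2) : 3 <= k1 -> 3 <= k2 ->
  @adj (twin (k1 + k2).+2 k1) (chain_snd k1 i) (chain_snd k1 j) = adj i j.
Proof.
move=> k13 k23; rewrite zigzag_adjE [LHS]/= /nat_adj -val_eqE.
rewrite [val _]chain_sndE [val (chain_snd k1 j)]chain_sndE !chain_sndE /twin_rel.
have := ltn_ord i; have := ltn_ord j => jn i_n.
move: (nat_of_ord i) (nat_of_ord j) jn i_n => a b bn an.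
case: (eqVneq a k2.+1) => ha; case: (eqVneq b k2.+1) => hb;
  by apply/idP/idP => h; splitb; try (exfalso; lia); solveb.
Qed.

Lemma two_zigzag_of_twin k1 k2 (G : sgraph) : 3 <= k1 -> 3 <= k2 ->
  iso (twin (k1 + k2).+2 k1) G -> two_zigzag_graph G.
Proof.
move=> k13 k23 I; have kn : k1 + 5 <= (k1 + k2).+2 by lia.
split; first exact: iso_regular4 I (twin_regular4 k13 kn).
case: I => phi bphi phiadj; exists k1, k2; split; [lia|lia|].
have fstE (i j : zigzag k1) : @adj (twin _ k1) (chain_fst k2 i) (chain_fst k2 j) = adj i j.
  rewrite zigzag_adjE /= /nat_adj -val_eqE /= /twin_rel.
  have := ltn_ord i; have := ltn_ord j => jn i_n.
  by apply/idP/idP => h; splitb; try (exfalso; lia); solveb.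
exists phi; split=> //.
- move=> x y xy; rewrite phiadj; case/orP: xy => /existsP[i /existsP[j /and3P[ij /eqP-> /eqP->]]].
    by rewrite fstE.
  by rewrite chain_snd_adj.
- apply: (@maximal_zigzag_of_zone _ k1 _ phi (zone1 k1) (zone2 k1)) => //; first lia.
  + exact: chain_fst_inj.
  + move=> x; rewrite /zone1 => xk; have xk' : x < k1.+2 by lia.
    by exists (Ordinal xk'); apply: val_inj.
  + by exists (inord 1); rewrite /zone2 /= inordK //; lia.
  + by move=> m g; apply: zigzag_in_zone.
- apply: (@maximal_zigzag_of_zone _ k1 _ phi (zone2 k1) (zone1 k1)) => //; first lia.
  + exact: chain_snd_inj.
  + by move=> i j; rewrite chain_snd_adj.
  + move=> x; rewrite /zone2 => xk; have xn := ltn_ord x.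
    exists (inord (if x == 0 :> nat then k2.+1 else x - k1.+1)); apply: val_inj.
    rewrite [RHS]chain_sndE inordK; last by splitif; lia.
    by rewrite /=; case: (eqVneq (nat_of_ord x) 0) xk => x0 xk; rewrite ?eqxx //; splitif; lia.
  + exists (inord 1); rewrite /zone1 chain_sndE inordK //; splitif; lia.
  + by move=> m g m0 gh; case: (zigzag_in_zone k13 kn m0 gh); [right|left].
Qed.

(** * Recognising twins *)

Lemma mem_edges (G : sgraph) (x y : G) : adj x y -> [set x; y] \in edges G.
Proof. by move=> xy; apply/imsetP; exists (x, y); rewrite ?inE. Qed.

Lemma zigzag_prepend (G : sgraph) q (c : zigzag q -> G) (y : G) :
  injective c -> homomorphism c -> (forall i, c i != y) ->
  adj y (c (inord 0)) -> adj y (c (inord 1)) ->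
  ~ maximal_zigzag_subgraph (image_subgraph c).
Proof.
move=> cI ch cy y0 y1 [_ mx].
pose g (i : zigzag q.+1) : G := if unlift ord0 (i : 'I_q.+3) is Some j then c j else y.
have gl (j : zigzag q) : g (lift ord0 (j : 'I_q.+2)) = c j by rewrite /g liftK.
have g0 : g ord0 = y by rewrite /g unlift_none.
have gI : injective g.
  move=> i j; rewrite /g; case: unliftP => [i' ->|->]; case: unliftP => [j' ->|->] //.
  - by move/cI->.
  - by move/eqP; rewrite (negbTE (cy _)).
  - by move/esym/eqP; rewrite (negbTE (cy _)).
have half (i j : zigzag q.+1) : (i : 'I__) < (j : 'I__) -> adj i j -> adj (g i) (g j).
  rewrite zigzag_adjE /g; case: (unliftP ord0 (i : 'I_q.+3)) => [i' ->|->];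
    case: (unliftP ord0 (j : 'I_q.+3)) => [j' ->|->]; rewrite /= /bump /= ?add1n ?add0n //.
  - by move=> ij h; apply: ch; rewrite zigzag_adjE.
  - move=> _ h; have [e|e] : j' = inord 0 \/ j' = inord 1.
      by case: j' h => [[|[|m]] hm] //= _; [left|right]; apply: val_inj; rewrite /= inordK.
    + by rewrite e.
    + by rewrite e.
have gh : homomorphism g.
  move=> i j ij; have [h|h|h] := ltngtP (i : 'I__) (j : 'I__).
  - exact: half.
  - by rewrite adj_sym; apply: half; rewrite // adj_sym.
  - by rewrite (val_inj h : i = j) adj_irr in ij.
have le : subgraph_le (image_subgraph c) (image_subgraph g).
  split; apply/subsetP => e.
    by move=> /imsetP[i _ ->]; rewrite -gl; apply: imset_f.
  move=> /image_edgeP[i [j [ij ->]]]; apply/image_edgeP.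
  exists (lift ord0 (i : 'I_q.+2)), (lift ord0 (j : 'I_q.+2)); rewrite !gl; split=> //.
have zg : zigzag_subgraph (image_subgraph g) by exists q.+1 => //; exists g.
have := mx _ zg le => /(congr1 fst) /= /setP /(_ y).
rewrite (_ : y \in _ = true); last by rewrite -g0; apply/imsetP; exists ord0.
by move/esym/imsetP => [i _ yi]; have := cy i; rewrite -yi eqxx.
Qed.

Section Chain.

Variables (G : sgraph) (k1 k2 : nat) (f : closed_chain k1 k2 -> G).
Hypotheses (k1_gt0 : 0 < k1) (k2_gt0 : 0 < k2) (order8 : 8 <= (k1 + k2).+2).
Hypotheses (bf : bijective f) (fh : homomorphism f) (rG : regular4 G).
Hypothesis max1 : maximal_zigzag_subgraph
  (image_subgraph (fun i : zigzag k1 => f (chain_fst k2 i))).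
Hypothesis max2 : maximal_zigzag_subgraph
  (image_subgraph (fun j : zigzag k2 => f (chain_snd k1 j))).

Let n := (k1 + k2).+2.
Let P (i : nat) : G := f (inord i).

Lemma chain_inj i j : i < n -> j < n -> P i = P j -> i = j.
Proof.
by move=> hi hj /(bij_inj bf) /(congr1 (@nat_of_ord _)); rewrite !inordK.
Qed.

Lemma chain_eqE i j : i < n -> j < n -> (P i == P j) = (i == j).
Proof. by move=> hi hj; apply/eqP/eqP => [/(chain_inj hi hj)|->]. Qed.

Lemma chain_surj y : exists2 i, i < n & y = P i.
Proof.
case: bf => g fK gK; exists (g y : 'I__); first exact: ltn_ord.
by rewrite /P inord_val gK.
Qed.

(** The closed chain is the squared cycle without the pairs {1, n-1} and
{k1, k1+2} that straddle the two end vertices. *)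
Definition chain_rel (i j : nat) : bool :=
  [&& circ_rel n i j, (i != k1) || (j != k1.+2) & (i != 1) || (j.+1 != n)].

Lemma chain_rel_adj i j : i < n -> j < n -> chain_rel i j -> adj (P i) (P j).
Proof.
move=> hi hj /and3P[h h1 h2]; apply: fh; rewrite /= /chain_adj; apply/orP.
rewrite /circ_rel /n in h h1 h2 hi hj *.
(* For [k2 = 1] the pair [0], [k1.+1] is an edge of the second zigzag, which is
   why [j <= i.+2] is part of the test. *)
have [/andP[j1 ij]|j1] := boolP ((j <= k1.+1) && (j <= i.+2)).
  left; apply/existsP; exists (inord i); apply/existsP; exists (inord j).
  apply/and3P; split; last 2 first.
  - by apply/eqP/val_inj; rewrite /= !inordK //; splitb; lia.
  - by apply/eqP/val_inj; rewrite /= !inordK //; splitb; lia.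
  by rewrite zigzag_adjE !inordK; splitb; try (exfalso; lia); solveb.
right; apply/existsP; exists (inord (if i == 0 then k2.+1 else i - k1.+1)).
apply/existsP; exists (inord (j - k1.+1)).
have ik : (if i == 0 then k2.+1 else i - k1.+1) < k2.+2 by splitif; lia.
have jk : j - k1.+1 < k2.+2 by lia.
have zone : ((i == 0) || (k1 < i)) && (k1 < j).
  by rewrite negb_and -!ltnNge in j1; splitb; try (exfalso; lia); solveb.
apply/and3P; split.
- rewrite zigzag_adjE !inordK //; case: (eqVneq i 0) h h1 h2 zone => i0 h h1 h2 zone;
    by splitb; try (exfalso; lia); solveb.
- apply/eqP/val_inj; rewrite [RHS]chain_sndE /= !inordK //.
  by case: (eqVneq i 0) zone => i0 zone; [rewrite eqxx|splitif; lia].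
- by apply/eqP/val_inj; rewrite [RHS]chain_sndE /= !inordK //; splitif; lia.
Qed.

Lemma chain_adj_circ i j : i < n -> j < n -> chain_rel i j || chain_rel j i -> adj (P i) (P j).
Proof. by move=> hi hj /orP[h|h]; [|rewrite adj_sym]; apply: chain_rel_adj. Qed.

(** Otherwise the first zigzag could be prolonged beyond its end [P 0]. *)
Lemma chain_no_prolong1 q : q < n -> k1.+1 < q -> adj (P q) (P 0) -> ~~ adj (P q) (P 1).
Proof.
move=> qn kq q0; apply/negP => q1.
apply: (zigzag_prepend (c := fun i : zigzag k1 => f (chain_fst k2 i)) (y := P q)) max1.
- by move=> i j /(bij_inj bf) /chain_fst_inj.
- move=> i j ij; apply: fh; apply/orP; left; apply/existsP; exists i; apply/existsP; exists j.
  by rewrite ij !eqxx.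
- move=> i; apply/eqP => /(bij_inj bf) /(congr1 (@nat_of_ord _)); rewrite inordK //=.
  have := ltn_ord i; lia.
- by rewrite (_ : chain_fst _ _ = inord 0) //; apply: val_inj; rewrite /= !inordK.
- by rewrite (_ : chain_fst _ _ = inord 1) //; apply: val_inj; rewrite /= !inordK.
Qed.

(** Otherwise the second zigzag could be prolonged beyond its end [P k1.+1]. *)
Lemma chain_no_prolong2 q : 0 < q <= k1 -> adj (P q) (P k1.+1) -> ~~ adj (P q) (P k1.+2).
Proof.
move=> /andP[q0 qk] qa; apply/negP => qb.
have qn : q < n by rewrite /n; lia.
apply: (zigzag_prepend (c := fun i : zigzag k2 => f (chain_snd k1 i)) (y := P q)) max2.
- by move=> i j /(bij_inj bf) /chain_snd_inj.
- move=> i j ij; apply: fh; apply/orP; right; apply/existsP; exists i; apply/existsP; exists j.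
  by rewrite ij !eqxx.
- move=> i; apply/eqP => /(bij_inj bf) /(congr1 (@nat_of_ord _)); rewrite chain_sndE inordK //.
  by splitif; lia.
- rewrite (_ : chain_snd _ _ = inord k1.+1) //; apply: val_inj.
  rewrite [LHS]chain_sndE /= !inordK //.
  by splitif; lia.
- by rewrite /n; lia.
- rewrite (_ : chain_snd _ _ = inord k1.+2) //; apply: val_inj.
  rewrite [LHS]chain_sndE /= !inordK //.
  by splitif; lia.
- by rewrite ?/n; lia.
Qed.

Lemma chain_not_adj1 : ~~ adj (P 1) (P n.-1).
Proof.
have hn : n.-1 < n by [].
rewrite adj_sym; apply: (chain_no_prolong1 hn); first by rewrite /n; lia.
apply: chain_adj_circ => //; rewrite /chain_rel /circ_rel; apply/orP; right; rewrite /n.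
by move: k1_gt0 k2_gt0; clear; move=> *; solveb.
Qed.

Lemma chain_not_adj2 : ~~ adj (P k1) (P k1.+2).
Proof.
apply: chain_no_prolong2; first by rewrite leqnn k1_gt0.
apply: chain_adj_circ; rewrite ?/n; [lia|lia|].
rewrite /chain_rel /circ_rel /n; move: k1_gt0 k2_gt0; clear; move=> *.
by apply/orP; left; solveb.
Qed.

(** The positions next to the ends of the zigzags; all others have degree 4 in
the chain already. *)
Definition special (p : nat) : bool := [|| p == 1, p == k1, p == k1.+2 | p.+1 == n].

Lemma chain_full p q : p < n -> q < n -> ~~ special p -> adj (P p) (P q) ->
  circ_rel n p q || circ_rel n q p.
Proof.
move=> hp hq np pq.
pose s := [:: if p.+1 < n then p.+1 else 0; if p.+2 < n then p.+2 else p.+2 - n;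
   if 0 < p then p.-1 else n.-1; if 1 < p then p.-2 else n + p - 2].
have us : uniq s.
  by rewrite /= !inE !negb_or; clear -hp order8 n; rewrite /n in hp *; splitif; solveb.
have sn : all (fun x => x < n) s.
  by rewrite /=; clear -hp order8 n; rewrite /n in hp *; splitif; solveb.
have sc : all (fun x => circ_rel n p x || circ_rel n x p) s.
  by rewrite /= /circ_rel; clear -hp order8 n; rewrite /n in hp *; splitif; solveb.
have sr : all (fun x => chain_rel p x || chain_rel x p) s.
  rewrite /= /chain_rel /circ_rel; rewrite /special in np; clear -hp order8 n np k1_gt0 k2_gt0.
  by rewrite /n in hp np *; splitif; solveb.
have : P q \in map P s.
  apply: (neighbours_complete rG _ _ _ pq) => //.
    rewrite map_inj_in_uniq // => x y /(allP sn) hx /(allP sn) hy; exact: chain_inj.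
  rewrite all_map; apply/allP => x xs /=; apply: chain_adj_circ => //; first exact: (allP sn).
  exact: (allP sr).
by case/mapP => x xs /(chain_inj hq (allP sn _ xs)) ->; exact: (allP sc).
Qed.

(** The pairs that maximality and the degrees allow to be adjacent: the edges of
the chain, and the pairs of special positions that prolong no zigzag. *)
Definition chain_edge (p q : nat) : bool :=
  [&& p < q, (p != 1) || (q.+1 != n), (p != k1) || (q != k1.+2) &
   [|| circ_rel n p q, (p == 1) && (q == k1), (p == 1) && (q == k1.+2),
       (p == k1) && (q.+1 == n) | (p == k1.+2) && (q.+1 == n)]].

Lemma chain_adj_lt p q : p < q -> q < n -> adj (P p) (P q) -> chain_edge p q.
Proof.
move=> pq qn a; have pn := ltn_trans pq qn.
have e1 : (p != 1) || (q.+1 != n).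
  rewrite -negb_and; apply/negP => /andP[/eqP p1 /eqP q1].
  by have := chain_not_adj1; rewrite -q1 /= -p1 a.
have e2 : (p != k1) || (q != k1.+2).
  rewrite -negb_and; apply/negP => /andP[/eqP p1 /eqP q1].
  by have := chain_not_adj2; rewrite -q1 /= -p1 a.
rewrite /chain_edge pq e1 e2; have [//|nc /=] := boolP (circ_rel n p q).
have nc' : ~~ circ_rel n q p.
  by rewrite /circ_rel; clear -pq pn; lia.
have sp : special p.
  by apply: contraR nc => sp; have := chain_full pn qn sp a; rewrite (negbTE nc') orbF.
have sq : special q.
  apply: contraR nc => sq; have := chain_full qn pn sq.
  by rewrite adj_sym a (negbTE nc') => /(_ isT).
rewrite /special in sp sq; move: k1_gt0 k2_gt0 => k1_0 k2_0.
clear -sp sq e1 e2 pq qn k1_0 k2_0; rewrite /n in sp sq e1 qn *.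
by splitb; try (exfalso; lia); solveb.
Qed.

Lemma chain_adj_cases p q : p < n -> q < n -> adj (P p) (P q) ->
  chain_edge p q || chain_edge q p.
Proof.
move=> pn qn a; have [h|h|h] := ltngtP p q.
- by rewrite chain_adj_lt.
- by rewrite orbC chain_adj_lt // adj_sym.
- by rewrite h adj_irr in a.
Qed.

Lemma chain_another p (s : seq nat) : p < n -> size s < 4 ->
  exists q, [/\ q < n, adj (P p) (P q), q \notin s & chain_edge p q || chain_edge q p].
Proof.
move=> pn s4; have [|y a ys] := @another_neighbour G (P p) (map P s) rG.
  by rewrite size_map.
have [q qn yE] := chain_surj y; rewrite yE in a ys; exists q; split=> //.
  by apply: contra ys => qs; apply: map_f.
exact: chain_adj_cases.
Qed.

(** For [k1 = 1] the two missing neighbours of [P 1] would have to be the special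
positions [3] and [n.-1], which prolong a zigzag. *)
Lemma chain_k1_ge2 : 1 < k1.
Proof.
rewrite ltn_neqAle k1_gt0 andbT; apply/negP => /eqP k11.
have [q [qn _ qs qe]] := @chain_another 1 [:: 0; 2] isT isT.
rewrite !inE in qs; rewrite /chain_edge /circ_rel /n -k11 in qe.
by move: qs qe order8; rewrite -k11; clear; move=> *; splitb; lia.
Qed.

(** For [k2 = 1] the two missing neighbours of [P k1.+2] would have to be the
special positions [1] and [k1], which prolong a zigzag. *)
Lemma chain_k2_ge2 : 1 < k2.
Proof.
rewrite ltn_neqAle k2_gt0 andbT; apply/negP => /eqP k21.
have hn : k1.+2 < n by rewrite /n; lia.
have [q [qn _ qs qe]] := @chain_another k1.+2 [:: 0; k1.+1] hn isT.
rewrite !inE in qs; rewrite /chain_edge /circ_rel /n -k21 in qe qn.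
by move: qs qe qn order8; rewrite -k21; clear; move=> *; splitb; lia.
Qed.

Lemma chain_complete p q (s : seq nat) : p < n -> q < n -> uniq s -> size s = 4 ->
  all (fun x => x < n) s -> (forall x, x \in s -> adj (P p) (P x)) ->
  adj (P p) (P q) -> q \in s.
Proof.
move=> pn qn us ss sn sa a.
have : P q \in map P s.
  apply: (neighbours_complete rG _ _ _ a); rewrite ?size_map //.
    rewrite map_inj_in_uniq // => x y /(allP sn) hx /(allP sn) hy; exact: chain_inj.
  by rewrite all_map; apply/allP => x /sa.
by case/mapP => x xs /(chain_inj qn (allP sn _ xs)) ->.
Qed.

Lemma chain_neighbours1 q : q < n -> q \in [:: 0; 2; 3] -> adj (P 1) (P q).
Proof.
move=> qn qs; apply: chain_adj_circ => //; rewrite /chain_rel /circ_rel /n.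
have h1 := chain_k1_ge2; have h2 := chain_k2_ge2.
by rewrite !inE in qs; clear -qs h1 h2; splitb; solveb.
Qed.

Lemma chain_neighboursk q : q < n -> q \in [:: k1.+1; k1.-1; k1.-2] -> adj (P k1) (P q).
Proof.
move=> qn qs; apply: chain_adj_circ => //; rewrite /chain_rel /circ_rel /n; first by lia.
have h1 := chain_k1_ge2; have h2 := chain_k2_ge2.
by rewrite !inE in qs; clear -qs h1 h2; splitb; solveb.
Qed.

(** Joining [1] to [k1] would leave only four edges at the ends of the first
zigzag between its inner vertices and the rest of the graph. *)
Lemma chain_not_adj_inner : internally_6_edge_connected G -> 3 < k1 -> ~~ adj (P 1) (P k1).
Proof.
move=> [_ cG] k4; apply/negP => a1k; have h2 := chain_k2_ge2.
have kn : k1.+2 < n by rewrite /n; lia.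
have nb1 q : q < n -> adj (P 1) (P q) -> q \in [:: 0; 2; 3; k1].
  move=> qn; apply: chain_complete => //=.
  - by rewrite !inE; lia.
  - by rewrite /n; lia.
  - by move=> x; rewrite !inE => /or4P[] /eqP->; rewrite // chain_neighbours1 // /n; lia.
have nbk q : q < n -> adj (P k1) (P q) -> q \in [:: k1.+1; k1.-1; k1.-2; 1].
  move=> qn; apply: chain_complete => //=.
  - by lia.
  - by rewrite !inE; lia.
  - by rewrite /n; lia.
  - move=> x; rewrite !inE => /or4P[] /eqP->; rewrite ?[adj (P k1) (P 1)]adj_sym //;
      by rewrite chain_neighboursk // ?inE ?eqxx ?orbT // /n; lia.
pose F : {set {set G}} := [set e in [:: [set P 0; P 1]; [set P 0; P 2];
   [set P k1.-1; P k1.+1]; [set P k1; P k1.+1]]].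
have Fe : F \subset edges G.
  apply/subsetP => e; rewrite !inE => /or4P[] /eqP->; apply: mem_edges.
  - by rewrite adj_sym chain_neighbours1.
  - by apply: chain_adj_circ => //; rewrite /chain_rel /circ_rel /n; clear -k4; solveb.
  - apply: chain_adj_circ; rewrite /n; try lia.
    by rewrite /chain_rel /circ_rel /n; clear -k4 h2; solveb.
  - by rewrite chain_neighboursk ?inE ?eqxx //; lia.
have Fc : #|F| <= 5 by rewrite cardsE (leq_trans (card_size _)).
case: (bf) => g fK gK.
have gP i : i < n -> g (P i) = i :> nat by move=> hi; rewrite /P fK inordK.
pose A := [set y | 0 < (g y : 'I__) <= k1].
have PA i : i < n -> (P i \in A) = (0 < i <= k1) by move=> hi; rewrite inE gP.
have cA : closed (remove_edges F) A.
  apply: intro_closed; first exact: sym_connect_sym (@remove_edges_sym G F).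
  move=> x y /andP[]; have [p pn ->] := chain_surj x; have [q qn ->] := chain_surj y.
  move=> a nF pA; rewrite PA // in pA; rewrite PA //; apply: contraR nF => qA.
  have hF : [|| (p == 1) && (q == 0), (p == 2) && (q == 0),
      (p == k1.-1) && (q == k1.+1) | (p == k1) && (q == k1.+1)].
    have n1 : (p != 1) || (q != k1.+2).
      rewrite -negb_and; apply/negP => /andP[/eqP p1 /eqP q1].
      rewrite p1 in a; have := nb1 _ qn a.
      by rewrite q1 !inE; lia.
    have nk : (p != k1) || (q.+1 != n).
      rewrite -negb_and; apply/negP => /andP[/eqP p1 /eqP q1].
      rewrite p1 in a; have := nbk _ qn a.
      by rewrite !inE; move: q1; rewrite /n; lia.
    have := chain_adj_cases pn qn a; rewrite /chain_edge /circ_rel.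
    move: pn qn pA qA n1 nk k4 h2; rewrite /n; clear; move=> *.
    by splitb; try (exfalso; lia); solveb.
  rewrite !inE !eq_set2; case/or4P: hF => /andP[/eqP-> /eqP->];
    by rewrite !eqxx ?orbT.
have nconn x y : x \in A -> y \notin A -> connect (remove_edges F) x y = false.
  by move=> xA yA; apply/negP => /(closed_connect cA); rewrite xA (negbTE yA).
have n0 : 0 < n by []. have n1 : 1 < n by []. have n2 : 2 < n by lia.
have k1n : k1.+1 < n by lia.
have [v vE] : exists v : G, forall x y : G,
    connect (remove_edges F) x y = ((x == v) == (y == v)).
  apply: cG => // -[_ /(_ (P 1) (P 0))]; rewrite nconn // PA //; lia.
have c10 : connect (remove_edges F) (P 1) (P 0) = false by rewrite nconn ?PA //; lia.
have c20 : connect (remove_edges F) (P 2) (P 0) = false by rewrite nconn ?PA //; lia.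
have c1k : connect (remove_edges F) (P 1) (P k1.+1) = false by rewrite nconn ?PA //; lia.
move: c10 c20 c1k; rewrite !vE.
have [e1|_] := eqVneq (P 1) v; last first.
  have [e0|//] := eqVneq (P 0) v; have [ek|//] := eqVneq (P k1.+1) v.
  by have := chain_eqE n0 k1n; rewrite e0 ek eqxx.
have [e0|_] := eqVneq (P 0) v; first by [].
have [e2|//] := eqVneq (P 2) v.
by have := chain_eqE n1 n2; rewrite e1 e2 eqxx.
Qed.

(** The fourth neighbour of [P 1] is [P k1] or [P k1.+2], and [P k1] is excluded
by the previous lemma.  Then [P k1] can only be joined to [P n.-1].  If [k1 = 2],
then [P 1] prolongs the second zigzag, and if [k2 = 2], then [P k1.+2] prolongs
the first. *)
Lemma chain_iso_twin : internally_6_edge_connected G -> iso_twin G.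
Proof.
move=> cG; have h1 := chain_k1_ge2; have h2 := chain_k2_ge2.
have k2n : k1.+2 < n by rewrite /n; lia.
have kn : k1 < n by lia.
have ln : n.-1 < n by [].
have a1 : adj (P 1) (P k1.+2).
  have [q [qn a qs qe]] := @chain_another 1 [:: 0; 2; 3] isT isT.
  have : (q == k1) || (q == k1.+2).
    rewrite !inE in qs; rewrite /chain_edge /circ_rel in qe.
    by move: h1 qs qe; clear; move=> *; splitb; try (exfalso; lia); solveb.
  case/orP => /eqP qE; last by rewrite -qE.
  have k4 : 3 < k1 by move: qs; rewrite qE !inE; lia.
  by rewrite qE in a; have := chain_not_adj_inner cG k4; rewrite a.
have nb1 q : q < n -> adj (P 1) (P q) -> q \in [:: 0; 2; 3; k1.+2].
  move=> qn; apply: chain_complete => //=.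
  - by rewrite !inE; lia.
  - by rewrite /n; lia.
  - by move=> x; rewrite !inE => /or4P[] /eqP->; rewrite // chain_neighbours1 // /n; lia.
have ak : adj (P k1) (P n.-1).
  have [q [qn a qs qe]] := @chain_another k1 [:: k1.+1; k1.-1; k1.-2] kn isT.
  have : (q == 1) || (q.+1 == n).
    rewrite !inE in qs; rewrite /chain_edge /circ_rel in qe.
    by move: h1 h2 qs qe; rewrite /n; clear; move=> *; splitb; try (exfalso; lia); solveb.
  case/orP => /eqP qE; last by rewrite -qE.
  rewrite qE adj_sym in a; have := nb1 _ kn a; move: qs; rewrite qE !inE.
  by move: h1; clear; lia.
have k13 : 2 < k1.
  rewrite ltn_neqAle h1 andbT; apply/negP => /eqP k12.
  have := @chain_no_prolong2 1; rewrite k1_gt0 a1 => /(_ isT) H.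
  by apply: (negP (H _)) => //; apply: chain_neighbours1; rewrite ?inE -?k12 // /n; lia.
have k23 : 2 < k2.
  rewrite ltn_neqAle h2 andbT; apply/negP => /eqP k22.
  have H := @chain_no_prolong1 k1.+2 k2n (ltnSn _).
  apply: (negP (H _)); last by rewrite adj_sym.
  apply: chain_adj_circ => //; rewrite /chain_rel /circ_rel /n -k22.
  by move: h1; clear => *; apply/orP; right; solveb.
have k5 : k1 + 5 <= n by rewrite /n; lia.
exists n, k1; split=> //; pose h (i : twin n k1) : G := P (i : 'I_n).
have hI : injective h by move=> i j /(chain_inj (ltn_ord i) (ltn_ord j)) /val_inj.
have half i j : i < n -> j < n -> twin_rel n k1 i j -> adj (P i) (P j).
  move=> hi hj ij.
  have [/andP[/eqP-> /eqP->] //|n1] := boolP ((i == 1) && (j == k1.+2)).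
  have [/andP[/eqP-> /eqP jE]|nk] := boolP ((i == k1) && (j.+1 == n)); first by rewrite -jE in ak.
  apply: chain_rel_adj => //; rewrite /twin_rel in ij; rewrite /chain_rel /circ_rel.
  by move: hi hj ij n1 nk k13 k23; rewrite /n; clear => *; splitb; try (exfalso; lia); solveb.
apply: (iso_of_homomorphism hI).
- by rewrite -(bij_eq_card bf) !card_ord.
- move=> i j /andP[_ /orP[]] ij; first exact: half.
  by rewrite adj_sym; apply: half.
- exact: twin_min_degree4.
- exact: rG.
Qed.

End Chain.

Lemma two_zigzag_iso_twin (G : sgraph) : completed_primitive G -> two_zigzag_graph G ->
  8 <= graph_order G -> iso_twin G.
Proof.
move=> [rG cG] [_ [k1 [k2 [k10 k20 [f [bf fh m1 m2]]]]]] o8.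
apply: (chain_iso_twin k10 k20 _ bf fh rG m1 m2 cG).
by move: o8; rewrite /graph_order -(bij_eq_card bf) card_ord.
Qed.

(** * Counting *)

Lemma iso_twin_balanced (G : sgraph) : iso_twin G ->
  exists n k, [/\ 3 <= k, k.*2 + 2 <= n & iso (twin n k) G].
Proof.
move=> [n [k [k3 kn I]]]; have [h|h] := leqP (k.*2 + 2) n; first by exists n, k.
have kj : k + (n - k - 2) + 2 = n by lia.
have rj : regular4 (twin n (n - k - 2)) by apply: twin_regular4; lia.
have [f [bf fadj _]] := twin_swap k3 kn kj rj.
exists n, (n - k - 2); split; [lia|lia|].
by apply: iso_trans I; apply: iso_sym; exists f.
Qed.

(** The zigzag with [n - k - 2] triangles of the first twin must embed in the
second, whose zigzags have at most [n - k' - 2] triangles. *)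
Lemma twin_iso_le n k k' : 3 <= k -> k.*2 + 2 <= n -> 3 <= k' -> k'.*2 + 2 <= n ->
  iso (twin n k) (twin n k') -> k' <= k.
Proof.
move=> k3 kn k3' kn' [phi bphi phiadj].
have [q nE] : exists q, n = (k + q).+2 by exists (n - k - 2); lia.
have q3 : 3 <= q by lia.
subst n; pose g (j : zigzag q) := phi (chain_snd k j).
have gI : injective g by move=> i j /(bij_inj bphi) /chain_snd_inj.
have gh : homomorphism g by move=> i j ij; rewrite phiadj chain_snd_adj.
have kn5 : k' + 5 <= (k + q).+2 by lia.
by have [] := zigzag_size_in_twin k3' kn5 (ltnW (ltnW q3)) gI gh; lia.
Qed.

Lemma twin_iso_inj n k k' : 3 <= k -> k.*2 + 2 <= n -> 3 <= k' -> k'.*2 + 2 <= n ->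
  iso (twin n k) (twin n k') -> k = k'.
Proof.
move=> k3 kn k3' kn' I; apply/eqP; rewrite eqn_leq.
by rewrite (twin_iso_le k3' kn' k3 kn (iso_sym I)) (twin_iso_le k3 kn k3' kn' I).
Qed.

Lemma labelled_edges_iso n (r : rel nat) :
  iso (labelled_graph (edges (nat_graph n r))) (nat_graph n r).
Proof.
exists id; first by exists id.
move=> x y; rewrite [RHS]/= /labelled_adj; apply/idP/andP => [xy|[xy /imsetP[[a b] + /eqP]]].
  by split; [apply: adj_neq xy | exact: (@mem_edges (nat_graph n r))].
rewrite inE eq_set2 /= => ab /orP[] /andP[/eqP-> /eqP->] //.
by rewrite nat_adj_sym.
Qed.

(** The balanced twins [twin n k] with [k] from 3 to [n./2 - 1] represent each
isomorphism class exactly once. *)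
Lemma num_level2_descendants n :
  num_iso_classes (fun G => K5_descendant G /\ level G = 2%Z) n = n./2 - 3.
Proof.
pose R (E F : {set {set 'I_n}}) := `[< iso (labelled_graph E) (labelled_graph F) >].
pose D := [set E : {set {set 'I_n}} | [forall e in E, #|e| == 2] &&
  `[< K5_descendant (labelled_graph E) /\ level (labelled_graph E) = 2%Z >]].
pose cls E := [set F in D | R E F].
have -> : num_iso_classes (fun G => K5_descendant G /\ level G = 2%Z) n =
  #|[set cls E | E in D]| by [].
have RP E F : reflect (iso (labelled_graph E) (labelled_graph F)) (R E F) by apply: asboolP.
have DP (E : {set {set 'I_n}}) : reflect
    ((forall e, e \in E -> #|e| == 2) /\ iso_twin (labelled_graph E)) (E \in D).
  rewrite inE; apply: (iffP andP) => -[h1 h2]; split.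
  - exact/forall_inP.
  - by apply/level2_descendantP; apply: asboolW h2.
  - exact/forall_inP.
  - by apply: asboolT; apply/level2_descendantP.
pose code (i : 'I_(n./2 - 3)) : {set {set 'I_n}} := edges (twin n (i + 3)).
have codeI i : iso (labelled_graph (code i)) (twin n (i + 3)) by apply: labelled_edges_iso.
have bounds (i : 'I_(n./2 - 3)) : [/\ 3 <= i + 3, (i + 3).*2 + 2 <= n & (i + 3) + 5 <= n].
  by have := ltn_ord i; split; lia.
have codeD i : code i \in D.
  apply/DP; split.
    move=> e /imsetP[[x y] + ->]; rewrite inE /= => xy.
    by rewrite cards2; case/andP: xy => ->.
  have [h1 _ h3] := bounds i; exists n, (i + 3); split=> //.
  exact: iso_sym (codeI i).
have clsE E F : R E F -> cls E = cls F.
  move/RP => EF; apply/setP => H; rewrite !in_set; congr (_ && _).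
  by apply/RP/RP => h; [apply: iso_trans h; apply: iso_sym | apply: iso_trans h].
have -> : [set cls E | E in D] = [set cls (code i) | i : 'I_(n./2 - 3)].
  apply/setP => C; apply/imsetP/imsetP => [[E /DP[_ ED] ->]|[i _ ->]].
    2: by exists (code i); [exact: codeD|].
  have [m [k [k3 km I]]] := iso_twin_balanced ED.
  have mn : m = n by have := iso_order I; rewrite /graph_order !card_ord.
  subst m; have kb : k - 3 < n./2 - 3 by lia.
  exists (Ordinal kb) => //; apply: clsE; apply/RP.
  have kE : Ordinal kb + 3 = k by rewrite /=; lia.
  by apply: iso_trans (iso_sym I) _; rewrite -{1}kE; apply: iso_sym.
rewrite card_imset ?card_ord // => i j E.
have : code j \in cls (code i) by rewrite E in_set codeD; apply/RP; apply: iso_refl.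
rewrite in_set => /andP[_ /RP I].
have [h1 h2 _] := bounds i; have [h1' h2' _] := bounds j.
have := twin_iso_inj h1 h2 h1' h2' (iso_trans (iso_sym (codeI i)) (iso_trans I (codeI j))).
by move=> /addIn /val_inj.
Qed.

Lemma coef_denominator (j : nat) :
  (((1 - 'X) * (1 - 'X^2) : {poly int})`_j =
   (j == 0%N)%:R - (j == 1%N)%:R - (j == 2%N)%:R + (j == 3%N)%:R)%R.
Proof.
have -> : ((1 - 'X) * (1 - 'X^2) = 1 - 'X - 'X^2 + 'X^3 :> {poly int})%R.
  by ring.
by rewrite !coefD !coefN coef1 coefX !coefXn.
Qed.

Lemma gen_fun_half : gen_fun_eq_fraction (fun n => n./2 - 3)
  'X^8%R ((1 - 'X) * (1 - 'X^2))%R.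
Proof.
move=> n; rewrite coefXn; under eq_bigr => i _ do rewrite coef_denominator.
case: n => [|[|[|n]]].
- by rewrite !big_ord_recl big_ord0.
- by rewrite !big_ord_recl big_ord0.
- by rewrite !big_ord_recl big_ord0.
rewrite !big_ord_recr big1 /= ?add0r => [|i _]; last first.
  have := ltn_ord i => hi.
  have [-> -> -> ->] : [/\ (n.+3 - i == 0) = false, (n.+3 - i == 1) = false,
     (n.+3 - i == 2) = false & (n.+3 - i == 3) = false] by split; lia.
  by rewrite /= !GRing.subr0 ?GRing.addr0 GRing.mulr0.
have [-> -> -> ->] : [/\ n.+3 - n = 3, n.+3 - n.+1 = 2, n.+3 - n.+2 = 1 & n.+3 - n.+3 = 0].
  by split; lia.
rewrite /= uphalf_half -[n in RHS]odd_double_half; move: (odd n) (n./2) => b h.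
have -> : ((b + h.*2).+3 == 8)%N = b && (h == 2)%N by case: b; lia.
by case: b => /=; have [->|h2] := eqVneq h 2 => /=; lia.
Qed.

Theorem proposition3p5 :
  (forall G : sgraph,
     (K5_descendant G /\ level G = 2%Z) <->
     [/\ completed_primitive G, two_zigzag_graph G & 8 <= graph_order G]) /\
  gen_fun_eq_fraction
    (num_iso_classes (fun G => K5_descendant G /\ level G = 2%Z))
    'X^8%R ((1 - 'X) * (1 - 'X^2))%R.
Proof.
split=> [G|n]; last first.
  by rewrite -gen_fun_half; apply: eq_bigr => i _; rewrite num_level2_descendants.
split=> [dG|[pG zG oG]]; last exact/level2_descendantP/two_zigzag_iso_twin.
have /level2_descendantP[n [k [k3 kn I]]] := dG.
have [q nE] : exists q, n = (k + q).+2 by exists (n - k - 2); lia.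
subst n; split.
- exact: K5_descendant_completed_primitive (proj1 dG).
- by apply: two_zigzag_of_twin I; lia.
- by rewrite -(iso_order I) /graph_order card_ord; lia.
Qed.
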